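(* Let $f:\mathbb{R}^n\to\mathbb{R}$ be convex and twice continuously differentiable, and suppose: (1) there is $M>0$ with $\|\nabla^2 f(x)-\nabla^2 f(y)\|\le M\|x-y\|$ for all $x,y\in\mathbb{R}^n$; (2) there is $x^*\in\mathbb{R}^n$ with $f(x^* )=f^*:=\min_x f(x)$. Let $0<\epsilon_f<1$ and $0<\epsilon_g<1$. Then it takes at most $$O\left(\epsilon_f^{-2/7}\log(1/\epsilon_g)\right)$$ $\mathrm{TR}_+$ oracle calls for the Accelerated Trust-Region Extragradient Method (Algorithm 2 in the context) to find an $(\epsilon_f,\epsilon_g)$-approximate solution, i.e. a point $x$ satisfying $f(x)-f^*\le\epsilon_f$ or $\|\nabla f(x)\|\le\epsilon_g$.
   Context: $\|\cdot\|$ is the Euclidean norm (induced $\ell_2$ norm for matrices); $\log$ is base $2$. $\mathrm{TR}_+$ oracle. $(d,\lambda)=\mathrm{TR}_+(x,\sigma,r)$ is the primal-dual solution of $\min_d \nabla f(x)^Td+\frac12 d^T(\nabla^2f(x)+\sigma I)d$ subject to $\|d\|\le r$, where $\lambda$ is the multiplier of the ball constraint: $\|d\|\le r$, $\lambda\ge0$, $\lambda(\|d\|-r)=0$, $(\nabla^2f(x)+\sigma I+\lambda I)d=-\nabla f(x)$, $\nabla^2f(x)+\sigma I+\lambda I\succeq0$. Algorithm 2. Input $x_0=v_0\in\mathbb{R}^n$, $A_0=0$, search threshold $\theta>1$, $0<\eta<1$, damping parameter $0<\gamma\le\frac1\theta$, stationarity tolerance $\epsilon_g>0$. For $k=0,1,2,\dots$: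 with $$a_k(\sigma)=\frac{1+\sqrt{1+4A_k\sigma}}{2\sigma},\qquad y_k(\sigma)=\frac{A_k}{A_k+a_k(\sigma)}x_k+\frac{a_k(\sigma)}{A_k+a_k(\sigma)}v_k\qquad(\sigma>0),$$ run the search subroutine R&B below to get $(x_{k+1},\sigma_k,\mathrm{ET})$; if $\mathrm{ET}$ is True, terminate and output $x_{k+1}$; otherwise set $a_k=a_k(\sigma_k)$, $v_{k+1}=v_k-\gamma a_k\nabla f(x_{k+1})$, $A_{k+1}=A_k+a_k$. Subroutine R&B (at iteration $k$, writing $y(\sigma)=y_k(\sigma)$). Let $D_0=\|x_0-x^*\|$ and $G_0=\max\{\|\nabla f(x)\|:\ \|x-x^*\|\le(\frac{4}{\sqrt{3\gamma}}+1)D_0\}$. Set $\sigma_-=\sqrt{\frac{2M\epsilon_g}{1+2\theta}}$, $\sigma_+=\sqrt{\frac{MG_0}{\eta}}$, $(d_-,\lambda_-)=\mathrm{TR}_+(y(\sigma_-),\sigma_-,\frac1M\sigma_-)$. If $\lambda_-\le(\theta-1)\sigma_-$, output $(y(\sigma_-)+d_-,\sigma_-,\text{True})$. Otherwise repeat: $\sigma=\frac{\sigma_-+\sigma_+}{2}$, $(d,\lambda)=\mathrm{TR}_+(y(\sigma),\sigma,\frac1M\sigma)$; if [i) $\lambda=0$ and $\|d\|<\frac{\eta}{M}\sigma$] set $\sigma_+=\sigma$; if [ii) $\lambda>(\theta-1)\sigma$] set $\sigma_-=\sigma$; if neither i) nor ii) holds, output $(y(\sigma)+d,\sigma,\text{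False})$.
   Formalization: Since log(1/ε_g) vanishes as ε_g → 1 while at least one oracle call may be needed, the constant in O(·) is taken uniform over 0 < ε_g ≤ δ for each fixed δ < 1 (it may depend on δ), rather than over all 0 < ε_g < 1. *)

(* Defs.v *)
From HB Require Import structures.
From mathcomp Require Import all_boot all_order all_algebra.
From mathcomp Require Import all_classical all_reals all_analysis.

Set Implicit Arguments.
Unset Strict Implicit.
Unset Printing Implicit Defensive.

Import Order.TTheory GRing.Theory Num.Theory.
Import numFieldNormedType.Exports.

Local Open Scope classical_set_scope.
Local Open Scope ring_scope.

(* Points of R^n are row vectors, so a matrix A acts on a vector u as u *m A.
   The library norm on matrices is the max-norm: it is only used, as any norm
   could be, for differentiability and continuity; all metric quantities use
   the Euclidean norm below. *)

Section Euclidean.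
Context {R : realType}.

Definition dot n (u v : 'rV[R]_n) : R := \sum_(i < n) u 0 i * v 0 i.

Definition enorm n (u : 'rV[R]_n) : R := Num.sqrt (dot u u).

Definition opnorm n (A : 'M[R]_n) : R :=
  sup [set enorm (u *m A) | u in [set u : 'rV[R]_n | enorm u <= 1]].

Definition psd n (A : 'M[R]_n) : Prop := forall u : 'rV[R]_n, 0 <= dot (u *m A) u.

Definition log2 (x : R) : R := ln x / ln 2.

End Euclidean.

Section Calculus.
Context {R : realType} {n : nat}.
Implicit Types (f : 'rV[R]_n -> R) (x : 'rV[R]_n).

Definition grad f x : 'rV[R]_n := \row_(j < n) 'D_(delta_mx 0 j) f x.

Definition hess f x : 'M[R]_n := 'J (grad f) x.

Definition twice_continuously_differentiable f : Prop :=
  [/\ forall x, differentiable f x,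
      forall x, differentiable (grad f) x
    & continuous (hess f)].

Definition convex f : Prop :=
  @convex_function R ('rV[R]_n : lmodType R) setT f.

Definition lipschitz_hess f (M : R) : Prop :=
  forall x y, opnorm (hess f x - hess f y) <= M * enorm (x - y).

Definition minimizer f x : Prop := forall y, f x <= f y.

Definition approximate_solution f (xstar : 'rV[R]_n) (epsf epsg : R) x : Prop :=
  f x - f xstar <= epsf \/ enorm (grad f x) <= epsg.

Definition maximal_gradient_norm f (xstar : 'rV[R]_n) (rho G : R) : Prop :=
  (exists2 x, enorm (x - xstar) <= rho & G = enorm (grad f x)) /\
  (forall x, enorm (x - xstar) <= rho -> enorm (grad f x) <= G).

End Calculus.

Section TrustRegionOracle.
Context {R : realType} {n : nat}.
Variable f : 'rV[R]_n -> R.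

Definition tr_model (x : 'rV[R]_n) (sigma : R) (d : 'rV[R]_n) : R :=
  dot (grad f x) d + 2^-1 * dot (d *m (hess f x + sigma%:M)) d.

Definition tr_solution (x : 'rV[R]_n) (sigma r : R)
    (d : 'rV[R]_n) (lambda : R) : Prop :=
  enorm d <= r /\
  (forall d', enorm d' <= r -> tr_model x sigma d <= tr_model x sigma d') /\
  0 <= lambda /\
  lambda * (enorm d - r) = 0 /\
  d *m (hess f x + sigma%:M + lambda%:M) = - grad f x /\
  psd (hess f x + sigma%:M + lambda%:M).

Definition tr_oracle (TR : 'rV[R]_n -> R -> R -> 'rV[R]_n * R) : Prop :=
  forall x sigma r, 0 < sigma -> 0 < r ->
    tr_solution x sigma r (TR x sigma r).1 (TR x sigma r).2.

End TrustRegionOracle.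

Inductive search_phase (R : Type) : Type :=
| InitialTest
| Bisection of R & R.
Arguments InitialTest {R}.

(* [Running k x v A p]: outer iteration k with x_k = x, v_k = v, A_k = A, where
   the next oracle call of the search subroutine is the one made in phase p;
   [Bisection lo hi] carries the current values of sigma_- and sigma_+.
   [Terminated x]: the method stopped and output x. *)
Inductive config (R : realType) (n : nat) : Type :=
| Running of nat & 'rV[R]_n & 'rV[R]_n & R & search_phase R
| Terminated of 'rV[R]_n.
Arguments Running {R n}.
Arguments Terminated {R n}.

Section Algorithm.
Context {R : realType} {n : nat}.
Variables (f : 'rV[R]_n -> R) (TR : 'rV[R]_n -> R -> R -> 'rV[R]_n * R).
Variables (M G0 theta eta gamma epsg : R).

Definition stepsize (A sigma : R) : R :=
  (1 + Num.sqrt (1 + 4 * A * sigma)) / (2 * sigma).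

Definition extrapolate (x v : 'rV[R]_n) (A sigma : R) : 'rV[R]_n :=
  let a := stepsize A sigma in
  (A / (A + a)) *: x + (a / (A + a)) *: v.

Definition sigma_lo : R := Num.sqrt (2 * M * epsg / (1 + 2 * theta)).
Definition sigma_hi : R := Num.sqrt (M * G0 / eta).

(* Every step from a running configuration makes exactly one oracle call.
   Tests i) and ii) exclude each other, since (theta - 1) * sigma > 0, so their
   order is irrelevant. *)
Definition step (c : config R n) : config R n :=
  match c with
  | Terminated x => Terminated x
  | Running k x v A InitialTest =>
      let y := extrapolate x v A sigma_lo in
      let: (d, lambda) := TR y sigma_lo (M^-1 * sigma_lo) in
      if lambda <= (theta - 1) * sigma_lo then Terminated (y + d)
      else Running k x v A (Bisection sigma_lo sigma_hi)
  | Running k x v A (Bisection lo hi) =>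
      let sigma := (lo + hi) / 2 in
      let y := extrapolate x v A sigma in
      let: (d, lambda) := TR y sigma (M^-1 * sigma) in
      if (lambda == 0) && (enorm d < eta / M * sigma) then
        Running k x v A (Bisection lo sigma)
      else if (theta - 1) * sigma < lambda then
        Running k x v A (Bisection sigma hi)
      else
        let a := stepsize A sigma in
        let x' := y + d in
        Running k.+1 x' (v - (gamma * a) *: grad f x') (A + a) InitialTest
  end.

Definition run (x0 : 'rV[R]_n) (N : nat) : config R n :=
  iter N step (Running 0 x0 x0 0 InitialTest).

(* The point most recently returned by the search subroutine; the input x_0 is
   not counted. *)
Definition last_returned (c : config R n) : option 'rV[R]_n :=
  match c with
  | Running 0 _ _ _ _ => None
  | Running _.+1 x _ _ _ => Some x
  | Terminated x => Some x
  end.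

Definition finds_within (P : 'rV[R]_n -> Prop) (x0 : 'rV[R]_n) (N : nat) : Prop :=
  exists2 m, (m <= N)%N & exists2 x, last_returned (run x0 m) = Some x & P x.

End Algorithm.

(* Main.v *)
From HB Require Import structures.
Require Import Defs.
From mathcomp Require Import all_boot all_order all_algebra.
From mathcomp Require Import all_classical all_reals all_analysis.
From mathcomp Require Import zify ring lra.
Import Order.TTheory GRing.Theory Num.Theory.
Import numFieldNormedType.Exports.
Local Open Scope ring_scope.

(* With mu = sigma + lambda and d the oracle step from y, the Taylor estimate for
   the gradient shows that d is an approximate proximal step: grad f (y + d) +
   mu d has norm at most (sigma / 2) |d|.  Hence the potential
     2 gamma A_k (f x_k - f xs) + |v_k - xs|^2
   decreases by (3/4) gamma A_(k+1) sigma_k |d_k|^2 at each outer iteration; the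
   damping gamma <= 1/theta absorbs the slack lambda <= (theta - 1) sigma.  Since
   |d_k| >= eta sigma_k / M, the sum of A_k sigma_k^3 is bounded, and together
   with a_k^2 sigma_k = A_(k+1) this forces A_k to grow like k^(7/2).

   An interval [lo, hi] of the bisection has an active trust region at lo and a
   short regularized Newton step at hi.  The extrapolated point is Lipschitz in
   sigma, so both can only happen if hi - lo is at least a constant times
   epsg^2; hence the bisection depth is O(log (1 / epsg)). *)

(** * Euclidean geometry of row vectors and the induced matrix norm *)

Section Euclidean.
Context {R : realType} {n : nat}.
Implicit Types (u v w : 'rV[R]_n) (A : 'M[R]_n).

Lemma dotC u v : dot u v = dot v u.
Proof. by apply: eq_bigr => i _; rewrite mulrC. Qed.

Lemma dotDl u v w : dot (u + v) w = dot u w + dot v w.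
Proof.
by rewrite /dot -big_split; apply: eq_bigr => i _; rewrite /= mxE mulrDl.
Qed.

Lemma dotZl k u v : dot (k *: u) v = k * dot u v.
Proof. by rewrite /dot mulr_sumr; apply: eq_bigr => i _; rewrite mxE mulrA. Qed.

Lemma dotDr u v w : dot w (u + v) = dot w u + dot w v.
Proof. by rewrite dotC dotDl !(dotC w). Qed.

Lemma dotZr k u v : dot u (k *: v) = k * dot u v.
Proof. by rewrite dotC dotZl dotC. Qed.

Lemma dotNl u v : dot (- u) v = - dot u v.
Proof. by rewrite -scaleN1r dotZl mulN1r. Qed.

Lemma dotNr u v : dot u (- v) = - dot u v.
Proof. by rewrite dotC dotNl dotC. Qed.

Lemma dotBl u v w : dot (u - v) w = dot u w - dot v w.
Proof. by rewrite dotDl dotNl. Qed.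

Lemma dotBr u v w : dot w (u - v) = dot w u - dot w v.
Proof. by rewrite dotDr dotNr. Qed.

Lemma dot0l u : dot 0 u = 0.
Proof. by rewrite -(scale0r 0) dotZl mul0r. Qed.

Lemma dot_ge0 u : 0 <= dot u u.
Proof. by apply: sumr_ge0 => i _; rewrite -expr2 sqr_ge0. Qed.

Lemma enorm_ge0 u : 0 <= enorm u.
Proof. exact: sqrtr_ge0. Qed.

Lemma sqr_enorm u : enorm u ^+ 2 = dot u u.
Proof. by rewrite sqr_sqrtr ?dot_ge0. Qed.

Lemma dot_eq0 u : dot u u = 0 -> u = 0.
Proof.
move=> /eqP; rewrite psumr_eq0 => [/allP u0|i _]; last by rewrite -expr2 sqr_ge0.
apply/rowP => i; rewrite mxE; have := u0 i (mem_index_enum i).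
by rewrite /= mulf_eq0 orbb => /eqP.
Qed.

Lemma enorm_eq0 u : enorm u = 0 -> u = 0.
Proof. by move=> u0; apply: dot_eq0; rewrite -sqr_enorm u0 expr0n. Qed.

Lemma enorm_le u (c : R) : 0 <= c -> dot u u <= c ^+ 2 -> enorm u <= c.
Proof. by move=> c0 h; rewrite -ler_sqr ?nnegrE ?enorm_ge0// sqr_enorm. Qed.

Lemma cauchy_schwarz u v : dot u v <= enorm u * enorm v.
Proof.
have [u0|u0] := eqVneq (enorm u) 0.
  by rewrite (enorm_eq0 _ u0) dot0l mulr_ge0 ?enorm_ge0.
have [v0|v0] := eqVneq (enorm v) 0.
  by rewrite (enorm_eq0 _ v0) dotC dot0l mulr_ge0 ?enorm_ge0.
have up : 0 < enorm u by rewrite lt_def u0 enorm_ge0.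
have vp : 0 < enorm v by rewrite lt_def v0 enorm_ge0.
have := dot_ge0 (enorm v *: u - enorm u *: v).
rewrite dotBl !dotBr !dotZl !dotZr -!sqr_enorm (dotC v u) => h.
have : 0 <= (enorm u * enorm v) * (enorm u * enorm v - dot u v) by nra.
by rewrite pmulr_rge0 ?mulr_gt0// subr_ge0.
Qed.

Lemma enormD u v : enorm (u + v) <= enorm u + enorm v.
Proof.
apply: enorm_le; first by rewrite addr_ge0 ?enorm_ge0.
have := cauchy_schwarz u v.
rewrite dotDl !dotDr (dotC v u) -!sqr_enorm; nra.
Qed.

Lemma enormN u : enorm (- u) = enorm u.
Proof. by rewrite /enorm dotNl dotNr opprK. Qed.

Lemma enormB u v : enorm (u - v) <= enorm u + enorm v.
Proof. by rewrite -(enormN v) enormD. Qed.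

Lemma enormBC u v : enorm (u - v) = enorm (v - u).
Proof. by rewrite -enormN opprB. Qed.

Lemma enormZ k u : enorm (k *: u) = `|k| * enorm u.
Proof. by rewrite /enorm dotZl dotZr mulrA -expr2 sqrtrM ?sqr_ge0// sqrtr_sqr. Qed.

Lemma enorm0 : enorm (0 : 'rV[R]_n) = 0.
Proof. by rewrite /enorm dot0l sqrtr0. Qed.

Lemma enorm_le_dot u (c : R) : dot u u <= c * enorm u -> 0 <= c -> enorm u <= c.
Proof.
move=> h c0; have [->//|u0] := eqVneq (enorm u) 0.
have up : 0 < enorm u by rewrite lt_def u0 enorm_ge0.
by rewrite -(ler_pM2r up) -expr2 sqr_enorm.
Qed.

(** The [sup] in [opnorm] is meaningful only for a set bounded above: Cauchy-Schwarz on each column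
    gives the Frobenius norm as a bound. Homogeneity reduces [u] to a unit vector. *)
Lemma enorm_mulmx u A : enorm (u *m A) <= opnorm A * enorm u.
Proof.
pose K := \sum_(j < n) \sum_(i < n) A i j ^+ 2.
have K0 : 0 <= K by do 2!apply: sumr_ge0 => ? _; rewrite sqr_ge0.
have bnd v : dot (v *m A) (v *m A) <= dot v v * K.
  rewrite /dot /K mulr_sumr; apply: ler_sum => j _.
  have -> : (v *m A) 0 j = dot v (\row_i A i j).
    by rewrite mxE; apply: eq_bigr => i _; rewrite mxE.
  have -> : \sum_(i < n) A i j ^+ 2 = dot (\row_i A i j) (\row_i A i j).
    by apply: eq_bigr => i _; rewrite !mxE expr2.
  set w := \row_i _; rewrite -/(dot v v) -!sqr_enorm -expr2 -exprMn.
  have := cauchy_schwarz v w; have := cauchy_schwarz (- v) w.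
  by rewrite dotNl enormN; nra.
have [->|u0] := eqVneq u 0; first by rewrite mul0mx !enorm0 mulr0.
have up : 0 < enorm u.
  by rewrite lt_def enorm_ge0 andbT; apply: contra u0 => /eqP/enorm_eq0->.
have [v -> v1] : exists2 v, u = enorm u *: v & enorm v = 1.
  exists ((enorm u)^-1 *: u); first by rewrite scalerA divff ?scale1r ?gt_eqF.
  by rewrite enormZ ger0_norm ?invr_ge0 ?ltW// mulVf ?gt_eqF.
rewrite -scalemxAl !enormZ v1 mulr1 [leLHS]mulrC (gtr0_norm up) ler_pM2r//.
apply: ub_le_sup; last by exists v => //=; rewrite v1.
exists (Num.sqrt K) => _ [w /= w1 <-]; apply: enorm_le; first exact: sqrtr_ge0.
rewrite sqr_sqrtr// (le_trans (bnd w))// ler_piMl// -sqr_enorm.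
by rewrite exprn_ile1 ?enorm_ge0.
Qed.

End Euclidean.

(** * Derivatives along lines, convexity, and the Taylor bound for the gradient *)

Section LineDerivatives.
Context {R : realType} {n : nat}.
Implicit Types (u v w x d : 'rV[R]_n) (f : 'rV[R]_n -> R).

Lemma is_derive_line f x u (t : R) : (forall z, differentiable f z) ->
  is_derive t 1 (fun s : R => f (x + s *: u)) ('d f (x + t *: u) u).
Proof.
move=> df; pose l (s : R) : 'rV[R]_n := x + s *: u.
have dl : is_diff t l ( *:%R ^~ u).
  rewrite -[X in is_diff_def _ _ X]add0r.
  have h1 := is_diff_cst x t.
  have h2 := is_diff_scalel t u.
  exact: is_diffD h1 h2.
have dfl : is_diff t (f \o l) ('d f (l t) \o ( *:%R ^~ u)).
  by apply: is_diff_comp; apply: differentiableP.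
apply: DeriveDef; first by apply/diff_derivable; case: dfl.
by rewrite deriveE ?diff_val /= ?scale1r//; case: dfl.
Qed.

Lemma dot_continuous w : continuous ((@dot R n)^~ w).
Proof.
move=> v; apply: differentiable_continuous.
have -> : (@dot R n)^~ w = \sum_(i < n) (w 0 i *: (fun u : 'rV[R]_n => u 0 i : R)).
  apply/funext => u; rewrite fct_sumE; apply: eq_bigr => i _.
  by rewrite /GRing.scale/= mulrC.
by apply: differentiable_sum => i; apply: differentiableZ; exact: differentiable_coord.
Qed.

Lemma is_derive_dot_line (F : 'rV[R]_n -> 'rV[R]_n) x u w (t : R) :
  (forall z, differentiable F z) ->
  is_derive t 1 (fun s : R => dot (F (x + s *: u)) w)
    (dot (u *m 'J F (x + t *: u)) w).
Proof.
move=> dF.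
have dot_lin : linear ((@dot R n)^~ w) by move=> k u' v'; rewrite dotDl dotZl.
pose dotM := GRing.isLinear.Build _ _ _ _ _ dot_lin.
pose dotL : {linear 'rV[R]_n -> R} := HB.pack ((@dot R n)^~ w) dotM.
have cdot : continuous dotL by exact: dot_continuous.
have dfF z : differentiable (dotL \o F) z.
  by apply: differentiable_comp => //; exact: linear_differentiable.
have := is_derive_line _ x u t dfF.
rewrite diff_comp//; last exact: linear_differentiable.
by rewrite diff_lin//= /jacobian mul_rV_lin1.
Qed.

Lemma diff_grad f x u : differentiable f x -> 'd f x u = dot (grad f x) u.
Proof.
move=> df; rewrite {1}(row_sum_delta u) linear_sum; apply: eq_bigr => i _.
by rewrite linearZ /= mxE deriveE// mulrC.
Qed.

Lemma derive_ge0_of_min0 (h : R -> R) (l : R) : is_derive (0 : R) 1 h l ->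
  (forall t, 0 < t -> t < 1 -> h 0 <= h t) -> 0 <= l.
Proof.
move=> [dh <-] hmin; have := dh => /cvg_dnbhs_at_right /cvgr_to_ge; apply.
near=> t.
have t0 : 0 < t by near: t; exact: nbhs_right_gt.
have t1 : t < 1 by near: t; exact: nbhs_right_lt.
rewrite /= addr0 /GRing.scale/= mulr1.
by rewrite mulr_ge0 ?invr_ge0 ?(ltW t0)// subr_ge0 hmin.
Unshelve. all: by end_near. Qed.

(** The gap [h] between chord and function is nonnegative on the segment and vanishes at 0, so its
    derivative there is nonnegative. *)
Lemma convex_above_tangent f x y : convex f -> (forall z, differentiable f z) ->
  f x + dot (grad f x) (y - x) <= f y.
Proof.
move=> cf df; pose h (t : R) := f x + t * (f y - f x) - f (x + t *: (y - x)).
have dh : is_derive (0 : R) 1 h (f y - f x - dot (grad f x) (y - x)).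
  have d1 := is_derive_line f x (y - x) 0 df.
  rewrite scale0r addr0 diff_grad// in d1.
  have d2 := @is_deriveZ _ _ _ _ (f y - f x) _ _ _ (is_derive_id (0 : R) (1 : R)).
  have := is_deriveB (is_deriveD (is_derive_cst (f x) (0 : R) (1 : R)) d2) d1.
  rewrite add0r scaler1.
  have <- : h = cst (f x) + (f y - f x) \*: id - (fun t => f (x + t *: (y - x))).
    by apply/funext => t; rewrite /h /GRing.scale/= mulrC.
  by [].
suff /(derive_ge0_of_min0 h _ dh) : forall t, 0 < t -> t < 1 -> h 0 <= h t by lra.
move=> t t0 t1; rewrite /h mul0r scale0r !addr0 subrr subr_ge0.
have : f (t *: y + (1 - t) *: x) <= t * f y + (1 - t) * f x.
  have H := cf (Itv01 (ltW t0) (ltW t1)) y x (mem_setT _) (mem_setT _).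
  exact H.
have -> : t *: y + (1 - t) *: x = x + t *: (y - x).
  by rewrite scalerBl scale1r scalerBr addrCA.
lra.
Qed.

Lemma grad_monotone f x y : convex f -> (forall z, differentiable f z) ->
  0 <= dot (grad f y - grad f x) (y - x).
Proof.
move=> cf df; have := convex_above_tangent f x y cf df.
have := convex_above_tangent f y x cf df.
by rewrite -(opprB y x) dotNr dotBl; lra.
Qed.

(** Monotonicity of the gradient makes [dot (grad f (x + t *: u)) u] smallest at [t = 0] among
    [t >= 0]; its derivative there is the quadratic form. *)
Lemma hess_psd f x : convex f -> twice_continuously_differentiable f ->
  psd (hess f x).
Proof.
move=> cf [df dg _] u.
have := is_derive_dot_line (grad f) x u u 0 dg; rewrite scale0r addr0.
move=> /derive_ge0_of_min0; apply => t t0 _; rewrite scale0r addr0.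
have := grad_monotone f x (x + t *: u) cf df.
by rewrite addrAC subrr add0r dotZr pmulr_rge0// dotBl subr_ge0.
Qed.

(** The remainder [r] is tested against itself, which leaves a real function of [t]. Subtracting the
    claimed bound gives [h], nonincreasing on [0, 1] by the Lipschitz Hessian. *)
Lemma grad_taylor f (M : R) x d : twice_continuously_differentiable f ->
  0 <= M -> lipschitz_hess f M ->
  enorm (grad f (x + d) - grad f x - d *m hess f x) <= M / 2 * enorm d ^+ 2.
Proof.
move=> [_ dg _] M0 lip; set r := _ - _ - _.
apply: enorm_le_dot; last by rewrite mulr_ge0 ?divr_ge0 ?sqr_ge0.
pose K := M / 2 * enorm d ^+ 2 * enorm r.
pose h (t : R) := dot (grad f (x + t *: d)) r
   - (dot (d *m hess f x) r * t + K * t ^+ 2).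
have dh (t : R) : is_derive t 1 h (dot (d *m hess f (x + t *: d)) r
    - (dot (d *m hess f x) r + K * (2 * t))).
  have d1 := is_derive_dot_line (grad f) x d r t dg.
  have d2 := @is_deriveZ _ _ _ _ (dot (d *m hess f x) r) _ _ _ (is_derive_id t (1 : R)).
  have d3 := @is_deriveZ _ _ _ _ K _ _ _ (is_deriveX 2 (is_derive_id t (1 : R))).
  have H := is_deriveB d1 (is_deriveD d2 d3).
  set g := (X in is_derive _ _ X _) in H.
  have -> : h = g.
    by apply/funext => s; rewrite /g /h !fctE /GRing.scale.
  set l := (X in is_derive _ _ _ X) in H.
  rewrite [X in is_derive _ _ _ X](_ : _ = l)//.
  by rewrite /l /hess /GRing.scale/= !mulr1 expr1.
suff: h 1 <= h 0.
  rewrite /h !scale1r !scale0r !addr0; rewrite {5}/r !dotBl. rewrite /K; lra.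
have dh' t : derivable h t 1 by case: (dh t).
apply: (@ler0_derive1_le_cc _ h 0 1) => //; rewrite ?in_itv/= ?lexx ?ler01//.
  move=> t; rewrite in_itv/= => /andP[t0 t1].
  rewrite derive1E; have [_ ->] := dh t.
  rewrite opprD addrA -dotBl -mulmxBr subr_le0.
  rewrite (le_trans (cauchy_schwarz _ _))//.
  have op := lip (x + t *: d) x.
  have xd : enorm (x + t *: d - x) = t * enorm d.
    by rewrite addrAC subrr add0r enormZ gtr0_norm.
  rewrite xd in op.
  have : enorm (d *m (hess f (x + t *: d) - hess f x)) <= M * (t * enorm d) * enorm d.
    by rewrite (le_trans (enorm_mulmx _ _))// ler_wpM2r ?enorm_ge0.
  by move=> /(ler_wpM2r (enorm_ge0 r)) /le_trans; apply; rewrite /K; lra.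
by apply: derivable_within_continuous => t _; exact: dh'.
Qed.

End LineDerivatives.

(** * The quadratic equation of the step size *)

Section Stepsize.
Context {R : realType}.
Variables (A sigma : R).
Hypotheses (A_ge0 : 0 <= A) (sigma_gt0 : 0 < sigma).
Let a := stepsize A sigma.

Lemma stepsize_gt0 : 0 < a.
Proof. by rewrite divr_gt0 ?mulr_gt0// ltr_pwDl// sqrtr_ge0. Qed.

Lemma stepsizeE : sigma * a ^+ 2 = A + a.
Proof.
rewrite /a /stepsize; set s := Num.sqrt _.
have s2 : s ^+ 2 = 1 + 4 * A * sigma by rewrite sqr_sqrtr// addr_ge0 ?mulr_ge0// ltW.
have sn0 : sigma != 0 by rewrite gt_eqF.
have -> : sigma * ((1 + s) / (2 * sigma)) ^+ 2 = (1 + 2 * s + s ^+ 2) / (4 * sigma).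
  by field.
by rewrite s2; field.
Qed.

End Stepsize.

(** * The extrapolated point and its dependence on [sigma] *)

Section Extrapolation.
Context {R : realType} {n : nat}.
Implicit Types (x v z : 'rV[R]_n).

Lemma extrapolateE x v (A sigma : R) : 0 <= A -> 0 < sigma ->
  (A + stepsize A sigma) *: extrapolate x v A sigma =
  A *: x + stepsize A sigma *: v.
Proof.
move=> A0 s0; have a0 := stepsize_gt0 A sigma s0.
have n0 : A + stepsize A sigma != 0 by rewrite gt_eqF// ltr_wpDl.
by rewrite /extrapolate scalerDr !scalerA ![(A + _) * _]mulrC !divfK.
Qed.

Lemma enorm_extrapolate_le x v z (A sigma rho : R) : 0 <= A -> 0 < sigma ->
  enorm (x - z) <= rho -> enorm (v - z) <= rho ->
  enorm (extrapolate x v A sigma - z) <= rho.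
Proof.
move=> A0 s0 xz vz; have a0 := stepsize_gt0 A sigma s0.
have n0 : 0 < A + stepsize A sigma by rewrite ltr_wpDl.
rewrite -(ler_pM2l n0) -[X in X * enorm _](gtr0_norm n0) -enormZ.
rewrite scalerBr extrapolateE// scalerDl opprD addrACA -!scalerBr.
rewrite (le_trans (enormD _ _))// !enormZ ger0_norm// (gtr0_norm a0) mulrDl.
by apply: lerD; rewrite ler_wpM2l// ltW.
Qed.

(** The weight of [v] is [2 / (1 + q sigma)], and rationalizing the difference of square roots gives
    a bound free of [A], hence uniform over the outer iterations. *)
Lemma extrapolate_lipschitz x v (A s t : R) : 0 <= A -> 0 < s -> s <= t ->
  enorm (extrapolate x v A t - extrapolate x v A s) <= (t - s) / s * enorm (v - x).
Proof.
move=> A0 s0 st; have t0 := lt_le_trans s0 st.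
pose q r := Num.sqrt (1 + 4 * A * r).
have q2 r : 0 < r -> q r ^+ 2 = 1 + 4 * A * r.
  by move=> r0; rewrite sqr_sqrtr// addr_ge0 ?mulr_ge0// ltW.
have q0 r : 0 <= q r by exact: sqrtr_ge0.
have weightE r : 0 < r -> extrapolate x v A r = x + (2 / (1 + q r)) *: (v - x).
  move=> r0; have a0 := stepsize_gt0 A r r0.
  have n0 : A + stepsize A r != 0 by rewrite gt_eqF// ltr_wpDl.
  have -> : 2 / (1 + q r) = stepsize A r / (A + stepsize A r).
    have rn0 : r != 0 by rewrite gt_eqF.
    have q1n0 : 1 + q r != 0 by rewrite gt_eqF// ltr_pwDl.
    rewrite -stepsizeE// /stepsize -/(q r); field.
    by rewrite rn0.
  rewrite /extrapolate.
  have -> : A / (A + stepsize A r) = 1 - stepsize A r / (A + stepsize A r) by field.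
  by rewrite scalerBl scale1r scalerBr -addrA [- _ + _]addrC.
rewrite !weightE// opprD addrACA subrr add0r -scalerBl enormZ.
rewrite ler_wpM2r ?enorm_ge0//.
have qs := q2 s s0; have qt := q2 t t0; have qs0 := q0 s; have qt0 := q0 t.
have qs1 : 1 <= q s by rewrite -(@ler_sqr _ 1) ?nnegrE// qs expr1n lerDl ?mulr_ge0// ltW.
have As0 : 0 <= A * (t - s) by rewrite mulr_ge0// subr_ge0.
have qst : q s <= q t by rewrite -ler_sqr ?nnegrE// qs qt; lra.
have -> : 2 / (1 + q t) - 2 / (1 + q s) =
    - (2 * (q t - q s) / ((1 + q t) * (1 + q s))).
  by field; rewrite !gt_eqF ?ltr_pwDl.
have d0 : 0 < (1 + q t) * (1 + q s) by rewrite mulr_gt0// ltr_pwDl.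
rewrite normrN ger0_norm; last by rewrite divr_ge0 ?(ltW d0)// mulr_ge0// subr_ge0.
rewrite ler_pdivrMr// [leRHS]mulrAC ler_pdivlMr//.
have p0 : 0 < q t + q s by lra.
rewrite -(ler_pM2r p0).
(* As [q r ^+ 2 = 1 + 4 * A * r], both sides equal [8 * A * s * (t - s)]. *)
have -> : 2 * (q t - q s) * s * (q t + q s) = 2 * (t - s) * (q s - 1) * (q s + 1).
  have -> : 2 * (q t - q s) * s * (q t + q s) = 2 * s * (q t ^+ 2 - q s ^+ 2) by ring.
  have -> : 2 * (t - s) * (q s - 1) * (q s + 1) = 2 * (t - s) * (q s ^+ 2 - 1) by ring.
  by rewrite qs qt; ring.
have -> : (t - s) * ((1 + q t) * (1 + q s)) * (q t + q s) =
  (t - s) * ((1 + q t) * (q t + q s)) * (q s + 1) by ring.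
rewrite ler_wpM2r//; first by lra.
rewrite -mulrA mulrCA ler_wpM2l ?subr_ge0//.
rewrite ler_pM//; lra.
Qed.

End Extrapolation.

(** * Estimates for one oracle step *)

Section TrustRegionSteps.
Context {R : realType} {n : nat}.
Variables (f : 'rV[R]_n -> R) (M : R).
Hypotheses (cvx : convex f) (smooth : twice_continuously_differentiable f).
Hypotheses (M_gt0 : 0 < M) (lip : lipschitz_hess f M).
Implicit Types (x y v d z : 'rV[R]_n) (sigma mu : R).

Lemma mulmx_shift d (H : 'M[R]_n) (s t : R) :
  d *m (H + s%:M + t%:M) = d *m H + (s + t) *: d.
Proof. by rewrite -addrA -raddfD mulmxDr mul_mx_scalar. Qed.

Lemma regularized_coercive x d mu :
  mu * enorm d ^+ 2 <= dot (d *m hess f x + mu *: d) d.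
Proof. by rewrite dotDl dotZl sqr_enorm lerDr hess_psd. Qed.

Lemma regularized_enorm_le x d mu : 0 < mu ->
  mu * enorm d <= enorm (d *m hess f x + mu *: d).
Proof.
move=> mu0; have [->|d0] := eqVneq (enorm d) 0; first by rewrite mulr0 enorm_ge0.
have dp : 0 < enorm d by rewrite lt_def d0 enorm_ge0.
rewrite -(ler_pM2r dp) -mulrA -expr2.
exact: le_trans (regularized_coercive x d mu) (cauchy_schwarz _ _).
Qed.

(** By the step equation, [mu *: d] cancels the linear Taylor model of the gradient, so only the
    remainder is left. *)
Lemma grad_residual y d mu : d *m hess f y + mu *: d = - grad f y ->
  enorm (grad f (y + d) + mu *: d) <= M / 2 * enorm d ^+ 2.
Proof.
move=> eqd; have -> : mu *: d = - grad f y - d *m hess f y.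
  by rewrite -eqd addrAC subrr add0r.
by rewrite addrA; apply: grad_taylor => //; exact: ltW.
Qed.

Lemma grad_step_le y d mu sigma : d *m hess f y + mu *: d = - grad f y ->
  0 <= mu -> enorm d <= sigma / M ->
  enorm (grad f (y + d)) <= mu * (sigma / M) + M / 2 * (sigma / M) ^+ 2.
Proof.
move=> eqd mu0 dr.
have -> : grad f (y + d) = (grad f (y + d) + mu *: d) - mu *: d by rewrite addrK.
rewrite (le_trans (enormB _ _))// addrC enormZ ger0_norm//.
apply: lerD; first by rewrite ler_wpM2l.
apply: le_trans (grad_residual _ _ _ eqd) _.
rewrite ler_wpM2l ?divr_ge0 ?(ltW M_gt0)// ler_sqr ?nnegrE ?enorm_ge0//.
by rewrite (le_trans _ dr) ?enorm_ge0.
Qed.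

(** Squaring [|grad f (y + d) + mu d| <= (mu / 2) |d|] isolates the inner product; [mu] is then
    replaced by [theta * sigma] in one term and by [sigma] in the other. *)
Lemma grad_dot_step_le y d mu sigma theta :
  d *m hess f y + mu *: d = - grad f y ->
  0 < sigma -> sigma <= mu -> mu <= theta * sigma -> enorm d <= sigma / M ->
  dot (grad f (y + d)) d <=
    - (enorm (grad f (y + d)) ^+ 2 / (2 * theta * sigma)
       + 3 / 8 * sigma * enorm d ^+ 2).
Proof.
move=> eqd s0 smu mus dr; have mu0 := lt_le_trans s0 smu.
set g := grad f (y + d); set D := enorm d; set G := enorm g.
have D0 : 0 <= D by exact: enorm_ge0.
have res : enorm (g + mu *: d) <= mu / 2 * D.
  apply: le_trans (grad_residual _ _ _ eqd) _; rewrite -/D expr2 mulrA ler_wpM2r//.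
  rewrite -mulrAC ler_pdivrMr// divfK// mulrC -ler_pdivlMr// (le_trans dr)//.
  by rewrite ler_pM2r ?invr_gt0.
have := res; rewrite -ler_sqr ?nnegrE ?enorm_ge0 ?mulr_ge0 ?divr_ge0 ?(ltW mu0)//.
rewrite sqr_enorm dotDl !dotDr !dotZl !dotZr (dotC d g) -!sqr_enorm -/D -/G => h.
have G2 : 0 <= G ^+ 2 by exact: sqr_ge0.
have D2 : 0 <= D ^+ 2 by exact: sqr_ge0.
have h1 : G ^+ 2 / (2 * mu) + 3 / 8 * mu * D ^+ 2 <= - dot g d.
  have m2 : 0 < 2 * mu by lra.
  rewrite -(ler_pM2r m2) mulrDl divfK ?gt_eqF//.
  move: h; generalize (dot g d), D, (G ^+ 2) => p q r h; nra.
rewrite lerNr; apply: le_trans h1; apply: lerD.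
  have m2 : 0 < 2 * mu by lra.
  have mt : 2 * mu <= 2 * theta * sigma by lra.
  by rewrite ler_wpM2l// lef_pV2 ?posrE// (lt_le_trans m2).
by rewrite ler_wpM2r// ler_wpM2l.
Qed.

End TrustRegionSteps.

(** * Decrease of the potential and containment of the iterates *)

Section OuterStep.
Context {R : realType} {n : nat}.
Variables (f : 'rV[R]_n -> R) (xs : 'rV[R]_n) (gamma theta : R).
Hypotheses (cvx : convex f) (diff_f : forall z, differentiable f z).
Hypotheses (gamma_gt0 : 0 < gamma) (theta_gt0 : 0 < theta).
Hypothesis gamma_le : gamma <= theta^-1.
Variables (x v y d : 'rV[R]_n) (A a sigma : R).
Hypotheses (A_ge0 : 0 <= A) (a_gt0 : 0 < a) (sigma_gt0 : 0 < sigma).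
Hypotheses (aE : sigma * a ^+ 2 = A + a).
Hypothesis yE : (A + a) *: y = A *: x + a *: v.

(** The tangent at [y + d] is used twice, towards [x] with weight [A] and towards [xs] with weight
    [a]; by [yE] the products with [x] and [v] combine into the one with [y], leaving [dot g d]. Its
    gradient term absorbs the square produced by the step in [v]. *)
Lemma potential_step (g := grad f (y + d)) :
  dot g d <= - (enorm g ^+ 2 / (2 * theta * sigma) + 3 / 8 * sigma * enorm d ^+ 2) ->
  2 * gamma * (A + a) * (f (y + d) - f xs) + enorm (v - (gamma * a) *: g - xs) ^+ 2
    + 3 / 4 * gamma * ((A + a) * sigma * enorm d ^+ 2)
  <= 2 * gamma * A * (f x - f xs) + enorm (v - xs) ^+ 2.
Proof.
have Aa0 : 0 < A + a by rewrite ltr_wpDl.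
have tx := convex_above_tangent f (y + d) x cvx diff_f.
have ts := convex_above_tangent f (y + d) xs cvx diff_f.
have gy : (A + a) * dot g y = A * dot g x + a * dot g v.
  by rewrite -!dotZr -dotDr yE.
have -> : enorm (v - (gamma * a) *: g - xs) ^+ 2 =
    enorm (v - xs) ^+ 2 - 2 * (gamma * a) * (dot g v - dot g xs)
    + (gamma * a) ^+ 2 * enorm g ^+ 2.
  rewrite addrAC !sqr_enorm -dotBr; move: (v - xs) => w.
  by rewrite dotBl !dotBr !dotZl !dotZr (dotC w g); ring.
rewrite -/g !(dotBr, dotDr) in tx ts *.
move: tx ts gy; set G := enorm g; set D := enorm d.
generalize (dot g x), (dot g y), (dot g v), (dot g xs), (dot g d), (f (y + d)),
  (f x), (f xs), (enorm (v - xs) ^+ 2) => gx gy gv gs gd F' F Fs V.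
move=> tx ts gyE gdE.
have G2 : 0 <= G ^+ 2 by exact: sqr_ge0.
have conv_le : (A + a) * (F' - Fs) - A * (F - Fs) <= (A + a) * gd + a * (gv - gs).
  have := ler_wpM2l A_ge0 tx; have := ler_wpM2l (ltW a_gt0) ts.
  move: gyE => *; nra.
have := ler_wpM2l (ltW Aa0) gdE => gdE'.
(* As [sigma * a ^+ 2 = A + a], this is [gamma <= theta^-1] scaled by [a ^+ 2 * G ^+ 2]. *)
have damp : gamma * (a ^+ 2 * G ^+ 2) <= (A + a) * (G ^+ 2 / (theta * sigma)).
  rewrite -aE; have -> : sigma * a ^+ 2 * (G ^+ 2 / (theta * sigma)) =
    theta^-1 * (a ^+ 2 * G ^+ 2) by field; rewrite !gt_eqF.
  by rewrite ler_wpM2r// mulr_ge0// sqr_ge0.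
have half : G ^+ 2 / (2 * theta * sigma) = G ^+ 2 / (theta * sigma) / 2.
  by field; rewrite !gt_eqF.
rewrite half in gdE'.
have := ler_wpM2l (ltW gamma_gt0) conv_le.
have := ler_wpM2l (ltW gamma_gt0) gdE'.
have := ler_wpM2l (ltW gamma_gt0) damp.
generalize (G ^+ 2 / (theta * sigma)) => W h1 h2 h3.
nra.
Qed.

(** Up to [d], the new point is an average of [x] and [v]. The bound for [v] is smaller by [c], and
    its weight [a] pays for [d] because [(A + a) * |d| <= a * c]; so the radius does not
    accumulate. *)
Lemma center_step (D0 c : R) : 0 <= c ->
  (A + a) * sigma * enorm d ^+ 2 <= c ^+ 2 ->
  enorm (v - xs) <= D0 -> enorm (x - xs) <= D0 + c ->
  enorm (y + d - xs) <= D0 + c.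
Proof.
move=> c0 dc vx xx.
have Aa0 : 0 < A + a by rewrite ltr_wpDl.
have ad : (A + a) * enorm d <= a * c.
  rewrite -ler_sqr ?nnegrE ?mulr_ge0 ?enorm_ge0 ?(ltW a_gt0) ?(ltW Aa0)//.
  have := ler_wpM2l (sqr_ge0 a) dc; rewrite -aE exprMn.
  nra.
rewrite -(ler_pM2l Aa0) -[X in X * enorm _](gtr0_norm Aa0) -enormZ.
have -> : (A + a) *: (y + d - xs) = A *: (x - xs) + a *: (v - xs) + (A + a) *: d.
  rewrite addrAC scalerDr scalerBr yE !scalerBr scalerDl opprD.
  by rewrite addrACA.
rewrite (le_trans (enormD _ _))// (le_trans (lerD (enormD _ _) (lexx _)))//.
rewrite !enormZ ger0_norm// (gtr0_norm a_gt0) (gtr0_norm Aa0).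
have := ler_wpM2l A_ge0 xx; have := ler_wpM2l (ltW a_gt0) vx; lra.
Qed.

End OuterStep.

(** * Growth of [A] and the exponent 2/7 *)

Section IterationCount.
Context {R : realType}.

(** With [b] the 14th root of [A], this turns a jump of the square root of [A] into a jump of its
    power 2/7. *)
Lemma pow7_gap_le (b b' : R) : 0 <= b -> b <= b' -> 0 < b' ->
  b' ^+ 7 - b ^+ 7 <= 2 * b' ^+ 3 * (b' ^+ 4 - b ^+ 4).
Proof.
move=> b0 bb' b'0; rewrite -(ler_pM2l b'0).
have b4 : b ^+ 4 <= b' ^+ 4 by rewrite lerXn2r ?nnegrE// ltW.
have b7 : b * b ^+ 7 <= b' * b ^+ 7 by rewrite ler_wpM2r ?exprn_ge0.
have h : (b' ^+ 4 - b ^+ 4) * (b' ^+ 4 + b ^+ 4) <=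
         (b' ^+ 4 - b ^+ 4) * (2 * b' ^+ 4).
  by rewrite ler_wpM2l ?subr_ge0// mulr_natl mulr2n lerD2l.
have e1 : b' * (2 * b' ^+ 3 * (b' ^+ 4 - b ^+ 4)) =
  (b' ^+ 4 - b ^+ 4) * (2 * b' ^+ 4) by ring.
have e2 : (b' ^+ 4 - b ^+ 4) * (b' ^+ 4 + b ^+ 4) =
  b' * (b' ^+ 7 - b ^+ 7) + (b' * b ^+ 7 - b * b ^+ 7) by ring.
by rewrite e1; apply: le_trans h; rewrite e2 lerDl subr_ge0.
Qed.

(* Either sigma is so small that b jumps by a definite amount, or the summand
   added to T is large; this replaces the usual Hoelder argument. *)
Lemma iteration_count_step (k : nat) (T b b' a sigma : R) :
  0 <= b -> 0 < b' -> 0 < a -> 0 < sigma -> 0 <= T ->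
  b' ^+ 14 = b ^+ 14 + a -> sigma * a ^+ 2 = b' ^+ 14 ->
  k%:R <= (4 + T) * b ^+ 4 ->
  k.+1%:R <= (4 + (T + b' ^+ 14 * sigma ^+ 3)) * b' ^+ 4.
Proof.
move=> b0 b'0 a0 s0 T0 bE sE kb.
have bb' : b <= b'.
  rewrite -(@ler_pXn2r _ 14) ?nnegrE ?(ltW b'0)// bE; lra.
have b4 : b ^+ 4 <= b' ^+ 4 by rewrite lerXn2r ?nnegrE// ltW.
have b4_ge0 : 0 <= b ^+ 4 by rewrite exprn_ge0.
pose u := Num.sqrt sigma.
have u0 : 0 < u by rewrite sqrtr_gt0.
have uE : sigma = u ^+ 2 by rewrite sqr_sqrtr// ltW.
have uaE : u * a = b' ^+ 7.
  apply/eqP; rewrite -(@eqrXn2 _ 2) ?mulr_ge0 ?exprn_ge0 ?(ltW u0) ?(ltW a0) ?(ltW b'0)//.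
  by rewrite exprMn -uE sE -exprM.
suff one : 1 <= 4 * (b' ^+ 4 - b ^+ 4) + b' ^+ 14 * sigma ^+ 3 * b' ^+ 4.
  rewrite -natr1; have := ler_wpM2l T0 b4; lra.
have t0 : 0 <= b' ^+ 14 * sigma ^+ 3 * b' ^+ 4.
  by rewrite !mulr_ge0 ?exprn_ge0 ?(ltW s0) ?(ltW b'0).
(* The sixth power of [u * b' ^+ 3] is the new summand times [b' ^+ 4], and [u * b' ^+ 3] is also
   the factor left by [pow7_gap_le]. *)
have [small|large] := leP (u * b' ^+ 3) 1; last first.
  suff : 1 <= b' ^+ 14 * sigma ^+ 3 * b' ^+ 4 by lra.
  have -> : b' ^+ 14 * sigma ^+ 3 * b' ^+ 4 = (u * b' ^+ 3) ^+ 6 by rewrite uE; ring.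
  by rewrite exprn_ege1// ltW.
suff : 1 <= 4 * (b' ^+ 4 - b ^+ 4) by lra.
have b3 : 0 < b' ^+ 3 by rewrite exprn_gt0.
have b7 : b ^+ 7 <= b' ^+ 7 by rewrite lerXn2r ?nnegrE// ltW.
have b7' : 0 < b' ^+ 7 by rewrite exprn_gt0.
have jump : 1 <= 2 * u * (b' ^+ 7 - b ^+ 7).
  rewrite -(ler_pM2r b7') mul1r.
  have aE : a = (b' ^+ 7 - b ^+ 7) * (b' ^+ 7 + b ^+ 7).
    have -> : (b' ^+ 7 - b ^+ 7) * (b' ^+ 7 + b ^+ 7) = b' ^+ 14 - b ^+ 14 by ring.
    by rewrite bE; ring.
  rewrite -{1}uaE aE.
  have -> : 2 * u * (b' ^+ 7 - b ^+ 7) * b' ^+ 7 =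
    u * (b' ^+ 7 - b ^+ 7) * (b' ^+ 7 + b' ^+ 7) by ring.
  by rewrite mulrA ler_wpM2l ?lerD2l// mulr_ge0 ?subr_ge0// ltW.
have := pow7_gap_le b b' b0 bb' b'0 => gap.
have gap' := ler_wpM2l (ltW u0) gap.
have d0 : 0 <= b' ^+ 4 - b ^+ 4 by rewrite subr_ge0.
have := ler_wpM2r d0 small; lra.
Qed.

(** Writing [A] as a 14th power makes its powers 1/2 and 2/7 the monomials [b ^+ 7] and [b ^+ 4]. *)
Lemma exists_root14 (A : R) : 0 <= A -> exists2 b, 0 <= b & A = b ^+ 14.
Proof.
move=> A0; exists (A `^ (14^-1)); first exact: powR_ge0.
by rewrite -powR_mulrn ?powR_ge0// -powRrM mulVf// powRr1.
Qed.

Lemma pow4_le_powR (b B e : R) : 0 <= b -> 0 <= B -> 0 < e ->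
  b ^+ 14 <= B * e^-1 -> b ^+ 4 <= B `^ (2 / 7) * e `^ (- (2 / 7)).
Proof.
move=> b0 B0 e0 h.
have -> : b ^+ 4 = (b ^+ 14) `^ (2 / 7).
  by rewrite -!powR_mulrn// -powRrM; congr (_ `^ _); field.
have -> : e `^ (- (2 / 7)) = e^-1 `^ (2 / 7)
  by rewrite -[e^-1]powR_inv1 ?(ltW e0)// -powRrM mulN1r.
rewrite -powRM ?invr_ge0 ?(ltW e0)//.
by apply: ge0_ler_powR; rewrite ?nnegrE ?exprn_ge0 ?mulr_ge0 ?invr_ge0 ?divr_ge0 ?(ltW e0).
Qed.

End IterationCount.

(** * Lower bound on the length of a bisection interval *)

Section BisectionGap.
Context {R : realType} {n : nat}.
Variables (f : 'rV[R]_n -> R) (M : R).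
Hypotheses (cvx : convex f) (smooth : twice_continuously_differentiable f).
Hypotheses (M_gt0 : 0 < M) (lip : lipschitz_hess f M).
Implicit Types (p q : 'rV[R]_n).

(** Bounded gradients bound the Hessian: a Taylor step of length [t] from [p] along [q - p] stays in
    the larger ball and controls [d *m hess f p]. The remainder from [p] to [q] is made linear by
    [|q - p| <= 2 * rho]. *)
Lemma grad_lipschitz_ball (xs : 'rV[R]_n) (rho t G : R) p q : 0 < t ->
  (forall z, enorm (z - xs) <= rho + t -> enorm (grad f z) <= G) ->
  enorm (p - xs) <= rho -> enorm (q - xs) <= rho ->
  enorm (grad f q - grad f p) <=
    (2 * G / t + M / 2 * t + M * rho) * enorm (q - p).
Proof.
move=> t0 bnd pr qr; set d := q - p; set e := enorm d.
have e0 : 0 <= e by exact: enorm_ge0.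
have erho : e <= 2 * rho.
  have -> : e = enorm ((q - xs) - (p - xs)) by rewrite opprB addrA subrK.
  by apply: le_trans (enormB _ _) _; lra.
have pdE : p + d = q by rewrite addrC subrK.
have taylor := fun u => grad_taylor f M p u smooth (ltW M_gt0) lip.
have [d0|dn0] := eqVneq e 0.
  by rewrite -pdE (enorm_eq0 _ d0) addr0 subrr enorm0 d0 mulr0.
have dp : 0 < e by rewrite lt_def dn0.
have Hd : enorm (d *m hess f p) <= (2 * G + M / 2 * t ^+ 2) * (e / t).
  pose u := (t / e) *: d.
  have tep : 0 < t / e by rewrite divr_gt0.
  have ue : enorm u = t by rewrite enormZ gtr0_norm// divfK.
  have pu : enorm (grad f (p + u)) <= G.
    by apply: bnd; rewrite addrAC (le_trans (enormD _ _))// ue lerD2r.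
  have pp : enorm (grad f p) <= G by apply: bnd; lra.
  have := taylor u; rewrite ue => tu.
  have -> : d *m hess f p = (e / t) *: (u *m hess f p).
    rewrite -scalemxAl scalerA -{1}[d *m hess f p]scale1r; congr (_ *: _).
    by field; rewrite !gt_eqF.
  have et0 : 0 < e / t by rewrite divr_gt0.
  rewrite enormZ gtr0_norm// mulrC ler_pM2r//.
  have -> : u *m hess f p = grad f (p + u) - grad f p -
      (grad f (p + u) - grad f p - u *m hess f p) by rewrite opprB [RHS]addrC subrK.
  apply: le_trans (enormB _ _) _.
  have := enormB (grad f (p + u)) (grad f p); lra.
have := taylor d; rewrite pdE => td.
have -> : grad f q - grad f p = d *m hess f p +
    (grad f q - grad f p - d *m hess f p) by rewrite [RHS]addrC subrK.
apply: le_trans (enormD _ _) _; rewrite -/e.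
have e2 : M / 2 * e ^+ 2 <= M * rho * e.
  have -> : M / 2 * e ^+ 2 = M * (e / 2) * e by ring.
  by rewrite ler_wpM2r// ler_wpM2l ?(ltW M_gt0)//; lra.
have -> : (2 * G / t + M / 2 * t + M * rho) * e =
  (2 * G + M / 2 * t ^+ 2) * (e / t) + M * rho * e by field; rewrite gt_eqF.
by apply: lerD => //; apply: le_trans e2.
Qed.

Variables (eta theta : R).
Hypotheses (eta_gt0 : 0 < eta) (eta_lt1 : eta < 1) (theta_gt1 : 1 < theta).

(* Either lo + lambda < hi, and hi - lo > lambda is large, or both steps are
   compared at the common shift hi: w = dq - dp solves
   w (H_q + hi) = - (lo + lambda - hi) dq + err, where the first term on the
   right points against w as soon as |dq| >= |dp|. *)
Lemma bisection_gap p q (dp dq : 'rV[R]_n) (lo hi lambda L : R) :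
  0 < lo -> lo < hi ->
  dp *m hess f p + hi *: dp = - grad f p -> enorm dp <= eta * hi / M ->
  dq *m hess f q + (lo + lambda) *: dq = - grad f q -> enorm dq = lo / M ->
  (theta - 1) * lo < lambda ->
  enorm (grad f p - grad f q) <= L * enorm (p - q) ->
  (theta - 1) * lo <= hi - lo \/
  hi * ((1 - eta) * lo - eta * (hi - lo)) <= M * (L + eta * hi) * enorm (p - q).
Proof.
move=> lo0 lohi eqp dpr eqq dqE ll gL; have hi0 := lt_trans lo0 lohi.
have [muhi|himu] := ltP (lo + lambda) hi; first by left; lra.
right; set e := enorm (p - q).
have e0 : 0 <= e by exact: enorm_ge0.
have gape : (1 - eta) * lo - eta * (hi - lo) = M * (lo / M - eta * hi / M).
  by field; rewrite gt_eqF.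
have L0 : 0 <= L * e by apply: le_trans gL; exact: enorm_ge0.
have rhs0 : 0 <= M * (L + eta * hi) * e.
  rewrite -mulrA mulr_ge0 ?(ltW M_gt0)// mulrDl addr_ge0//.
  by rewrite !mulr_ge0// ltW.
(* If [dq] is the shorter step, the left side is nonpositive, as
   [lo / M = |dq| < |dp| <= eta * hi / M]. *)
have [dd|dd] := ltP (enorm dq) (enorm dp).
  apply: le_trans rhs0; rewrite gape pmulr_rle0// pmulr_rle0//.
  by rewrite subr_le0 -dqE (le_trans (ltW dd)).
(* The mismatch of the two step equations once the Hessian at [p] is replaced by the one at [q]. *)
pose err := grad f p - grad f q - dp *m (hess f q - hess f p).
have err_le : enorm err <= (L + eta * hi) * e.
  rewrite mulrDl (le_trans (enormB _ _))//; apply: lerD => //.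
  have op := lip q p; rewrite enormBC -/e in op.
  apply: le_trans (enorm_mulmx _ _) _.
  apply: le_trans (ler_wpM2r (enorm_ge0 _) op) _.
  have -> : eta * hi * e = M * e * (eta * hi / M) by field; rewrite gt_eqF.
  by rewrite ler_wpM2l// mulr_ge0 ?(ltW M_gt0).
set w := dq - dp.
have weq : w *m hess f q + hi *: w = - ((lo + lambda - hi) *: dq) + err.
  have gqE : grad f q = - (dq *m hess f q + (lo + lambda) *: dq) by rewrite eqq opprK.
  have gpE : grad f p = - (dp *m hess f p + hi *: dp) by rewrite eqp opprK.
  rewrite /err gqE gpE /w mulmxBr mulmxBl.
  have entry (a b c u v l h : R) : a - b + h * (u - v) =
      - ((l - h) * u) + (- (c + h * v) - - (a + l * u) - (b - c)) by ring.
  by apply/rowP => i; rewrite !mxE; apply: entry.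
have := regularized_coercive f cvx smooth q w hi; rewrite weq dotDl dotNl dotZl.
have dqw : 0 <= dot dq w.
  rewrite dotBr -sqr_enorm subr_ge0 expr2.
  by rewrite (le_trans (cauchy_schwarz _ _))// ler_wpM2l ?enorm_ge0.
have mdqw : 0 <= (lo + lambda - hi) * dot dq w by rewrite mulr_ge0// subr_ge0.
move=> coer; have := cauchy_schwarz err w => errw.
have hw : hi * enorm w <= (L + eta * hi) * e.
  apply: le_trans err_le; have [->|w0] := eqVneq (enorm w) 0.
    by rewrite mulr0 enorm_ge0.
  have wp : 0 < enorm w by rewrite lt_def w0 enorm_ge0.
  rewrite -(ler_pM2r wp); move: coer; rewrite expr2; lra.
have dqdp : lo / M - eta * hi / M <= enorm w.
  have := enormD w dp; rewrite /w subrK dqE -/w; lra.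
rewrite gape mulrCA -[leRHS]mulrA ler_pM2l//.
by apply: le_trans hw; rewrite ler_pM2l.
Qed.

(** Adding the constants of the two alternatives of [bisection_gap] gives one bound linear in
    [hi - lo]. In the second, scaling by [lo] and [s ^+ 2] and cancelling [hi * lo] makes the
    constant independent of the interval. *)
Lemma bisection_gap_cube p q (dp dq : 'rV[R]_n) (lo hi lambda L K s kappa : R) :
  0 < s -> s <= kappa -> s <= lo -> lo < hi -> 0 <= L -> 0 <= K ->
  dp *m hess f p + hi *: dp = - grad f p -> enorm dp <= eta * hi / M ->
  dq *m hess f q + (lo + lambda) *: dq = - grad f q -> enorm dq = lo / M ->
  (theta - 1) * lo < lambda ->
  enorm (grad f p - grad f q) <= L * enorm (p - q) ->
  enorm (p - q) <= (hi - lo) / lo * K ->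
  s ^+ 3 <= (kappa ^+ 2 / (theta - 1) +
    (eta * kappa ^+ 2 + M * L * K + M * eta * K * kappa) / (1 - eta)) * (hi - lo).
Proof.
move=> s0 sk slo lohi L0 K0 eqp dpr eqq dqE ll gL eK.
have lo0 := lt_le_trans s0 slo; have hi0 := lt_trans lo0 lohi.
have k0 := lt_le_trans s0 sk.
have h0 : 0 < hi - lo by rewrite subr_gt0.
have t1 : 0 < theta - 1 by rewrite subr_gt0.
have e1 : 0 < 1 - eta by rewrite subr_gt0.
have s2k2 : s ^+ 2 <= kappa ^+ 2 by rewrite lerXn2r ?nnegrE// ltW.
have a1 : 0 <= kappa ^+ 2 / (theta - 1) * (hi - lo).
  by rewrite mulr_ge0 ?divr_ge0 ?sqr_ge0// ltW.
set B := (eta * _ + _ + _).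
have B0 : 0 <= B by rewrite !addr_ge0// !mulr_ge0// ltW.
have a2 : 0 <= B / (1 - eta) * (hi - lo) by rewrite mulr_ge0 ?divr_ge0// ltW.
have [gap|gap] := bisection_gap p q dp dq lo hi lambda L lo0 lohi eqp dpr eqq dqE ll gL.
  suff : s ^+ 3 <= kappa ^+ 2 / (theta - 1) * (hi - lo) by lra.
  rewrite mulrAC ler_pdivlMr//.
  have h1 : s * (theta - 1) <= hi - lo.
    by apply: le_trans gap; rewrite mulrC ler_pM2l.
  have -> : s ^+ 3 * (theta - 1) = s ^+ 2 * (s * (theta - 1)) by ring.
  by rewrite ler_pM ?sqr_ge0 ?mulr_ge0 ?(ltW s0) ?(ltW t1).
suff : s ^+ 3 <= B / (1 - eta) * (hi - lo) by lra.
rewrite mulrAC ler_pdivlMr//.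
have Lh0 : 0 <= M * (L + eta * hi) by rewrite mulr_ge0 ?addr_ge0 ?mulr_ge0// ltW.
have gap2 := le_trans gap (ler_wpM2l Lh0 eK).
have gap3 : hi * lo * ((1 - eta) * lo) <=
    (hi - lo) * (eta * (hi * lo) + M * L * K + M * eta * K * hi).
  have := ler_wpM2l (ltW lo0) gap2.
  have -> : lo * (M * (L + eta * hi) * ((hi - lo) / lo * K)) =
    (hi - lo) * (M * L * K + M * eta * K * hi) by field; rewrite gt_eqF.
  lra.
have hl : 0 < hi * lo by rewrite mulr_gt0.
have s2 : s ^+ 2 <= hi * lo by rewrite expr2 ler_pM// ?(ltW s0)// (le_trans slo)// ltW.
rewrite -(ler_pM2l hl).
have -> : hi * lo * (s ^+ 3 * (1 - eta)) = s ^+ 2 * (hi * lo * ((1 - eta) * s)) by ring.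
have st1 : s ^+ 2 * (hi * lo * ((1 - eta) * s)) <= s ^+ 2 * (hi * lo * ((1 - eta) * lo)).
  by rewrite ler_wpM2l ?sqr_ge0// ler_pM2l// ler_pM2l.
apply: le_trans st1 _.
apply: le_trans (ler_wpM2l (sqr_ge0 s) gap3) _.
have -> : hi * lo * (B * (hi - lo)) = (hi - lo) * (hi * lo * B) by ring.
rewrite mulrCA ler_pM2l// /B !mulrDr.
apply: lerD; first apply: lerD.
- have -> : s ^+ 2 * (eta * (hi * lo)) = hi * lo * (eta * s ^+ 2) by ring.
  by rewrite ler_pM2l// ler_pM2l.
- by rewrite ler_wpM2r// !mulr_ge0// ltW.
have -> : s ^+ 2 * (M * eta * K * hi) = hi * (s * s) * (M * eta * K) by ring.
have -> : hi * lo * (M * eta * K * kappa) = hi * (lo * kappa) * (M * eta * K) by ring.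
rewrite ler_wpM2r ?mulr_ge0 ?(ltW M_gt0) ?(ltW eta_gt0)// ler_pM2l//.
by rewrite ler_pM// ltW.
Qed.

End BisectionGap.

(** * Constants of the complexity bound *)

Section Constants.
Context {R : realType}.
Variables (M D0 G0 theta eta gamma : R).

(* Every x_k stays within D0 + drift of the minimizer, which leaves a margin of
   drift inside the ball of radius (4 / sqrt (3 gamma) + 1) D0 = D0 + 2 drift
   on which the gradient is at most G0; that margin bounds the Hessian. *)
Definition drift : R := 2 * D0 / Num.sqrt (3 * gamma).

(* For D0 = 0 this divides by drift = 0, but then all points coincide. *)
Definition grad_lip_const : R :=
  2 * G0 / drift + M / 2 * drift + M * (D0 + drift).

(** The value of [sigma_lo] at [epsg = 1], an upper bound for smaller tolerances. *)
Definition sigma_lo_max : R := Num.sqrt (2 * M / (1 + 2 * theta)).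

(** The factor in [bisection_gap_cube] for these [kappa] and [L]; [2 * D0 + drift] bounds the
    distance from [x_k] to [v_k]. *)
Definition gap_const : R :=
  sigma_lo_max ^+ 2 / (theta - 1) +
  (eta * sigma_lo_max ^+ 2 + M * grad_lip_const * (2 * D0 + drift) +
   M * eta * (2 * D0 + drift) * sigma_lo_max) / (1 - eta).

(** The first factor bounds [4 + T] in [outer_inv]; the second, times the power -2/7 of [epsf],
    bounds [b ^+ 4] while the gap to the minimum exceeds [epsf]. *)
Definition outer_const : R :=
  (4 + D0 ^+ 2 / (3 / 4 * gamma * (eta / M) ^+ 2)) *
  (D0 ^+ 2 / (2 * gamma)) `^ (2 / 7).

End Constants.

(** A search makes at most [J + 2] calls: the initial test and [J + 1] midpoints. Here [a] is the
    budget of the earlier searches. *)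
Lemma search_budget (m a j J : nat) :
  (m <= a + 1 + j)%N -> (j <= J)%N -> (m < J + 2 + a)%N.
Proof. lia. Qed.

(** * Invariants of the algorithm and its call budget *)

Section TrustRegionExtragradient.
Context {R : realType} {n : nat}.
Variables (M D0 G0 theta eta gamma epsg : R).
Hypotheses (M_gt0 : 0 < M) (theta_gt1 : 1 < theta).
Hypotheses (eta_gt0 : 0 < eta) (eta_lt1 : eta < 1).
Hypotheses (gamma_gt0 : 0 < gamma) (gamma_le : gamma <= theta^-1).
Hypotheses (epsg_gt0 : 0 < epsg) (epsg_lt1 : epsg < 1).
Variables (f : 'rV[R]_n -> R) (xs x0 : 'rV[R]_n).
Variable TR : 'rV[R]_n -> R -> R -> 'rV[R]_n * R.
Hypotheses (cvx : convex f) (smooth : twice_continuously_differentiable f).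
Hypotheses (lip : lipschitz_hess f M) (xs_min : minimizer f xs).
Hypothesis x0D0 : enorm (x0 - xs) = D0.
Hypothesis G0max :
  maximal_gradient_norm f xs ((4 / Num.sqrt (3 * gamma) + 1) * D0) G0.
Hypothesis oracle : tr_oracle f TR.

Let c := drift D0 gamma.
Let slo := sigma_lo M theta epsg.
Let shi := sigma_hi M G0 eta.
Let W := gap_const M D0 G0 theta eta gamma.
Let L := grad_lip_const M D0 G0 gamma.
Let kappa := sigma_lo_max M theta.

Lemma D0_ge0 : 0 <= D0.
Proof. by rewrite -x0D0 enorm_ge0. Qed.

Lemma drift_ge0 : 0 <= c.
Proof. by rewrite /c /drift !mulr_ge0 ?D0_ge0 ?invr_ge0 ?sqrtr_ge0. Qed.

Lemma sqr_drift : c ^+ 2 = 4 * D0 ^+ 2 / (3 * gamma).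
Proof.
have g3 : 0 < 3 * gamma by rewrite mulr_gt0.
by rewrite /c /drift exprMn exprVn sqr_sqrtr ?(ltW g3)// exprMn; ring.
Qed.

Lemma grad_le_G0 z : enorm (z - xs) <= D0 + c + c -> enorm (grad f z) <= G0.
Proof.
have [_ bnd] := G0max => h; apply: bnd; apply: le_trans h _.
by rewrite /c /drift le_eqVlt; apply/orP; left; apply/eqP; ring.
Qed.

Lemma G0_ge0 : 0 <= G0.
Proof. by have [[z _ ->] _] := G0max; exact: enorm_ge0. Qed.

Lemma grad_lip_const_ge0 : 0 <= L.
Proof.
have := D0_ge0; have := drift_ge0; have := G0_ge0 => *.
by rewrite /L /grad_lip_const -/c !addr_ge0// !mulr_ge0 ?invr_ge0 ?addr_ge0 ?(ltW M_gt0).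
Qed.

Lemma theta2_gt0 : 0 < 1 + 2 * theta.
Proof. by have := theta_gt1; lra. Qed.

Lemma sqr_sigma_lo : slo ^+ 2 = 2 * M * epsg / (1 + 2 * theta).
Proof. by rewrite sqr_sqrtr// divr_ge0 ?(ltW theta2_gt0)// !mulr_ge0 ?ltW. Qed.

Lemma sigma_lo_gt0 : 0 < slo.
Proof. by rewrite sqrtr_gt0 divr_gt0 ?theta2_gt0// !mulr_gt0. Qed.

Lemma sqr_sigma_hi : shi ^+ 2 = M * G0 / eta.
Proof. by rewrite sqr_sqrtr// divr_ge0 ?(ltW eta_gt0)// mulr_ge0 ?G0_ge0 ?ltW. Qed.

Lemma sqr_sigma_lo_max : kappa ^+ 2 = 2 * M / (1 + 2 * theta).
Proof. by rewrite sqr_sqrtr// divr_ge0 ?(ltW theta2_gt0)// mulr_ge0 ?ltW. Qed.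

Lemma sigma_lo_max_gt0 : 0 < kappa.
Proof. by rewrite sqrtr_gt0 divr_gt0 ?theta2_gt0// mulr_gt0. Qed.

Lemma sigma_loE : slo ^+ 2 = kappa ^+ 2 * epsg.
Proof. by rewrite sqr_sigma_lo sqr_sigma_lo_max mulrAC. Qed.

Lemma sigma_lo_le_max : slo <= kappa.
Proof.
rewrite -ler_sqr ?nnegrE ?(ltW sigma_lo_gt0) ?(ltW sigma_lo_max_gt0)//.
by rewrite sigma_loE ler_piMr ?sqr_ge0// ltW.
Qed.

Lemma oracle_facts y sigma d lambda : 0 < sigma ->
  TR y sigma (M^-1 * sigma) = (d, lambda) ->
  [/\ enorm d <= sigma / M, 0 <= lambda, lambda = 0 \/ enorm d = sigma / M &
      d *m hess f y + (sigma + lambda) *: d = - grad f y].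
Proof.
move=> s0 TRE; have r0 : 0 < M^-1 * sigma by rewrite mulr_gt0 ?invr_gt0.
have := oracle y sigma _ s0 r0.
rewrite TRE mulrC => -[dr [_ [l0 [compl [eqd _]]]]]; split => //.
  by move/eqP: compl; rewrite mulf_eq0 subr_eq0 => /orP[]/eqP; [left|right].
by rewrite -eqd mulmx_shift.
Qed.

(** [b] is the 14th root of [A]; [T] stands for the sum of [A_(i+1) * sigma_i ^+ 3] over past
    iterations, charged to the potential. *)
Definition outer_inv (k : nat) (x v : 'rV[R]_n) (A : R) : Prop :=
  exists b T,
  [/\ 0 <= b, 0 <= T, A = b ^+ 14, k%:R <= (4 + T) * b ^+ 4 &
      2 * gamma * A * (f x - f xs) + enorm (v - xs) ^+ 2
        + 3 / 4 * gamma * (eta / M) ^+ 2 * T <= D0 ^+ 2] /\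
  enorm (x - xs) <= D0 + c.

Lemma outer_inv0 : outer_inv 0 x0 x0 0.
Proof.
exists 0, 0; split; last by rewrite x0D0 lerDl drift_ge0.
by split; rewrite ?expr0n ?mulr0// mul0r add0r addr0 x0D0.
Qed.

Lemma outer_inv_A k x v A : outer_inv k x v A -> 0 <= A.
Proof. by move=> [b [T [[b0 _ -> _ _] _]]]; rewrite exprn_ge0. Qed.

Lemma outer_inv_v k x v A : outer_inv k x v A -> enorm (v - xs) <= D0.
Proof.
move=> oi; have A0 := outer_inv_A _ _ _ _ oi.
have [b [T [[b0 T0 AE _ E] _]]] := oi.
rewrite -ler_sqr ?nnegrE ?enorm_ge0 ?D0_ge0//.
have f0 : 0 <= 2 * gamma * A * (f x - f xs).
  by rewrite mulr_ge0 ?subr_ge0 ?xs_min// !mulr_ge0// ltW.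
have T0' : 0 <= 3 / 4 * gamma * (eta / M) ^+ 2 * T.
  by rewrite mulr_ge0// mulr_ge0 ?sqr_ge0// mulr_ge0// ltW.
lra.
Qed.

Lemma outer_inv_extrapolate k x v A sigma : outer_inv k x v A -> 0 < sigma ->
  enorm (extrapolate x v A sigma - xs) <= D0 + c.
Proof.
move=> oi s0; apply: enorm_extrapolate_le => //.
- exact: outer_inv_A oi.
- by have [b [T [_ ]]] := oi.
by rewrite (le_trans (outer_inv_v _ _ _ _ oi))// lerDl drift_ge0.
Qed.

Lemma outer_inv_step k x v A sigma d lambda
    (a := stepsize A sigma) (y := extrapolate x v A sigma) :
  outer_inv k x v A -> 0 < sigma ->
  d *m hess f y + (sigma + lambda) *: d = - grad f y ->
  0 <= lambda -> lambda <= (theta - 1) * sigma ->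
  eta / M * sigma <= enorm d -> enorm d <= sigma / M ->
  outer_inv k.+1 (y + d) (v - (gamma * a) *: grad f (y + d)) (A + a).
Proof.
move=> oi s0 eqd l0 lle dge dle.
have A0 := outer_inv_A _ _ _ _ oi; have vD0 := outer_inv_v _ _ _ _ oi.
have [b [T [[b0 T0 AE kb E] xc]]] := oi.
have a0 : 0 < a by exact: stepsize_gt0.
have aE : sigma * a ^+ 2 = A + a by exact: stepsizeE.
have yE : (A + a) *: y = A *: x + a *: v by exact: extrapolateE.
clearbody a y; have Aa0 : 0 < A + a by rewrite ltr_wpDl.
have th0 : 0 < theta by apply: lt_trans theta_gt1.
have [df _ _] := smooth.
have gd : dot (grad f (y + d)) d <=
    - (enorm (grad f (y + d)) ^+ 2 / (2 * theta * sigma) + 3 / 8 * sigma * enorm d ^+ 2).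
  by apply: (grad_dot_step_le f M smooth M_gt0 lip y d (sigma + lambda)) => //; lra.
have pot := potential_step f xs gamma theta cvx df gamma_gt0 th0 gamma_le
  x v y d A a sigma A0 a0 s0 aE yE gd.
set v' := v - (gamma * a) *: _ in pot *; clearbody v'.
have f0 z B : 0 <= B -> 0 <= 2 * gamma * B * (f z - f xs).
  by move=> B0; rewrite mulr_ge0 ?subr_ge0 ?xs_min// !mulr_ge0// ltW.
have fx := f0 x A A0; have fx' := f0 (y + d) (A + a) (ltW Aa0).
have T0' : 0 <= 3 / 4 * gamma * (eta / M) ^+ 2 * T.
  by rewrite mulr_ge0// mulr_ge0 ?sqr_ge0// mulr_ge0// ltW.
have v'0 : 0 <= enorm (v' - xs) ^+ 2 by exact: sqr_ge0.
(* The decrease of the potential is at most [D0 ^+ 2], and [drift] is chosen to match this. *)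
have dc : (A + a) * sigma * enorm d ^+ 2 <= c ^+ 2.
  rewrite sqr_drift ler_pdivlMr ?mulr_gt0//; lra.
have [b' b'0 AE'] := exists_root14 (A + a) (ltW Aa0).
have b'p : 0 < b'.
  by rewrite lt_def b'0 andbT; apply: contraTneq Aa0 => b'E; rewrite AE' b'E expr0n ltxx.
exists b', (T + b' ^+ 14 * sigma ^+ 3); split; last first.
  by apply: (center_step xs x v y d A a sigma) => //; exact: drift_ge0.
split => //.
- by rewrite addr_ge0// mulr_ge0 ?exprn_ge0// ltW.
- by apply: (iteration_count_step k T b b' a sigma) => //; rewrite -AE' -?AE.
have dd : (eta / M) ^+ 2 * (b' ^+ 14 * sigma ^+ 3) <= (A + a) * sigma * enorm d ^+ 2.
  have -> : (eta / M) ^+ 2 * (b' ^+ 14 * sigma ^+ 3) =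
    b' ^+ 14 * sigma * (eta / M * sigma) ^+ 2 by ring.
  rewrite -AE' ler_pM2l ?mulr_gt0// ler_sqr ?nnegrE ?enorm_ge0//.
  by rewrite !mulr_ge0 ?invr_ge0// ltW.
have := ler_wpM2l (ltW gamma_gt0) dd; lra.
Qed.

Lemma outer_inv_count k x v A epsf : outer_inv k x v A -> 0 < epsf ->
  epsf < f x - f xs ->
  k%:R <= outer_const M D0 eta gamma * epsf `^ (- (2 / 7)).
Proof.
move=> oi e0 fx; have [b [T [[b0 T0 AE kb E] _]]] := oi.
have A0 := outer_inv_A _ _ _ _ oi.
have vx0 : 0 <= enorm (v - xs) ^+ 2 by exact: sqr_ge0.
have q0 : 0 < 3 / 4 * gamma * (eta / M) ^+ 2.
  by rewrite mulr_gt0 ?exprn_gt0 ?divr_gt0// mulr_gt0.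
have g2 : 0 < 2 * gamma by rewrite mulr_gt0.
have T0' : 0 <= 3 / 4 * gamma * (eta / M) ^+ 2 * T by rewrite mulr_ge0// ltW.
have fA : 2 * gamma * A * epsf <= 2 * gamma * A * (f x - f xs).
  by rewrite ler_wpM2l ?mulr_ge0 ?(ltW gamma_gt0)// ltW.
have f0 : 0 <= 2 * gamma * A * epsf by rewrite !mulr_ge0// ltW.
have TD : T <= D0 ^+ 2 / (3 / 4 * gamma * (eta / M) ^+ 2).
  rewrite ler_pdivlMr//; lra.
have bD : b ^+ 14 <= D0 ^+ 2 / (2 * gamma) * epsf^-1.
  rewrite -AE ler_pdivlMr// ler_pdivlMr//; lra.
have b4 := pow4_le_powR b (D0 ^+ 2 / (2 * gamma)) epsf b0
  (divr_ge0 (sqr_ge0 _) (ltW g2)) e0 bD.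
apply: le_trans kb _; rewrite /outer_const -mulrA.
by rewrite ler_pM ?addr_ge0 ?exprn_ge0// lerD2l.
Qed.

(** [dp] is a short Newton step regularized by [hi]; [dq] and [lambda] form a boundary step at [lo]
    satisfying test ii); [j] counts halvings. [bisection_gap] takes these data as input. *)
Definition search_inv (x v : 'rV[R]_n) (A lo hi : R) (j : nat) : Prop :=
  exists dp dq lambda,
  [/\ slo <= lo, lo < hi, hi - lo = (shi - slo) / 2 ^+ j,
      dp *m hess f (extrapolate x v A hi) + hi *: dp =
        - grad f (extrapolate x v A hi) & enorm dp <= eta * hi / M] /\
  [/\ dq *m hess f (extrapolate x v A lo) + (lo + lambda) *: dq =
        - grad f (extrapolate x v A lo),
      enorm dq = lo / M & (theta - 1) * lo < lambda].

Lemma search_inv_depth k x v A lo hi j : outer_inv k x v A ->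
  search_inv x v A lo hi j ->
  2 ^+ j * (kappa ^+ 3 * epsg ^+ 2) <= W * shi.
Proof.
move=> oi [dp [dq [lambda [[slolo lohi wE eqp dpr] [eqq dqE ll]]]]].
have A0 := outer_inv_A _ _ _ _ oi; have vD0 := outer_inv_v _ _ _ _ oi.
have xc : enorm (x - xs) <= D0 + c by have [b [T [_ ]]] := oi.
have s0 := sigma_lo_gt0; have lo0 := lt_le_trans s0 slolo.
have hi0 := lt_trans lo0 lohi.
have D00 := D0_ge0; have c0 := drift_ge0; have k0 := sigma_lo_max_gt0.
have inball s : 0 < s -> enorm (extrapolate x v A s - xs) <= D0 + c.
  exact: outer_inv_extrapolate oi.
set p := extrapolate x v A hi in eqp *; set q := extrapolate x v A lo in eqq *.
have pr : enorm (p - xs) <= D0 + c by exact: inball.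
have qr : enorm (q - xs) <= D0 + c by exact: inball.
have pq : enorm (p - q) <= (hi - lo) / lo * (2 * D0 + c).
  apply: le_trans (extrapolate_lipschitz x v A lo hi A0 lo0 (ltW lohi)) _.
  rewrite ler_wpM2l ?divr_ge0 ?subr_ge0 ?(ltW lo0) ?(ltW lohi)//.
  have -> : v - x = (v - xs) - (x - xs) by rewrite opprB addrA subrK.
  by rewrite (le_trans (enormB _ _))//; lra.
have gL : enorm (grad f p - grad f q) <= L * enorm (p - q).
  have [D0E|D0n] := eqVneq D0 0.
    have cE : c = 0 by rewrite /c /drift D0E mulr0 mul0r.
    have onexs z : enorm (z - xs) <= D0 + c -> z = xs.
      rewrite D0E cE addr0 => z0; apply/eqP; rewrite -subr_eq0; apply/eqP.
      by apply: enorm_eq0; apply/eqP; rewrite eq_le z0 enorm_ge0.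
    by rewrite (onexs p)// (onexs q)// !subrr enorm0 mulr0.
  have cp : 0 < c.
    by rewrite /c /drift divr_gt0 ?mulr_gt0 ?sqrtr_gt0 ?mulr_gt0// lt_def D0n.
  apply: (grad_lipschitz_ball f M smooth M_gt0 lip xs (D0 + c) c G0 q p) => //.
  exact: grad_le_G0.
have cube : slo ^+ 3 <= W * (hi - lo).
  have K0 : 0 <= 2 * D0 + c by rewrite addr_ge0// mulr_ge0.
  exact: (bisection_gap_cube f M cvx smooth M_gt0 lip eta theta eta_gt0 eta_lt1
    theta_gt1 p q dp dq lo hi lambda L (2 * D0 + c) slo kappa s0 sigma_lo_le_max
    slolo lohi grad_lip_const_ge0 K0).
have W0 : 0 <= W.
  have h0 : 0 < hi - lo by rewrite subr_gt0.
  by rewrite -(pmulr_lge0 _ h0) (le_trans _ cube)// exprn_ge0// ltW.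
have j0 : 0 < (2 : R) ^+ j by rewrite exprn_gt0.
(* [slo ^+ 3] is [kappa ^+ 3] times the power 3/2 of [epsg]; the weaker power 2 avoids a fractional
   exponent. *)
have eps2 : kappa ^+ 3 * epsg ^+ 2 <= slo ^+ 3.
  rewrite -(ler_pM2l k0).
  have -> : kappa * (kappa ^+ 3 * epsg ^+ 2) = (kappa ^+ 2 * epsg) ^+ 2 by ring.
  rewrite -sigma_loE.
  have -> : (slo ^+ 2) ^+ 2 = slo * slo ^+ 3 by ring.
  by rewrite ler_wpM2r ?exprn_ge0 ?(ltW s0)// sigma_lo_le_max.
have := le_trans eps2 cube; rewrite wE mulrA ler_pdivlMr// mulrC => /le_trans; apply.
by rewrite ler_wpM2l// gerBl ltW.
Qed.

(** The failed test forces a boundary step at [slo]. At [shi] the algorithm makes no call; the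
    oracle serves here only to supply a step, which the size of [shi] makes interior and short. *)
Lemma initial_search_inv k x v A dq lambda : outer_inv k x v A ->
  TR (extrapolate x v A slo) slo (M^-1 * slo) = (dq, lambda) ->
  (theta - 1) * slo < lambda -> search_inv x v A slo shi 0.
Proof.
move=> oi TRE ll; have s0 := sigma_lo_gt0.
have [_ l0 compl eqq] := oracle_facts _ _ _ _ s0 TRE.
have th0 : 0 < (theta - 1) * slo by rewrite mulr_gt0// subr_gt0.
have dqE : enorm dq = slo / M.
  by case: compl => // l00; move: ll; rewrite l00 ltNge ltW.
have c0 := drift_ge0.
have gradG s : 0 < s -> enorm (grad f (extrapolate x v A s)) <= G0.
  move=> sp; apply: grad_le_G0; rewrite (le_trans (outer_inv_extrapolate _ _ _ _ _ oi sp))//.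
  by rewrite lerDl.
have stat s d mu : 0 < s -> 0 < mu ->
    d *m hess f (extrapolate x v A s) + mu *: d = - grad f (extrapolate x v A s) ->
    mu * enorm d <= G0.
  move=> sp mu0 eqd; apply: le_trans (gradG s sp); rewrite -(enormN (grad f _)) -eqd.
  exact: regularized_enorm_le.
(* The step at [slo] has length [slo / M], which the gradient bound permits only for small [slo];
   hence [slo < shi]. *)
have sG : slo ^+ 2 < M * G0.
  have mu0 : 0 < slo + lambda by rewrite ltr_wpDr.
  have h1 := stat _ _ _ s0 mu0 eqq; rewrite dqE in h1.
  have h2 : slo * (slo / M) < G0.
    by apply: lt_le_trans h1; rewrite ltr_pM2r ?divr_gt0// ltrDl (lt_trans th0).
  by move: h2; rewrite mulrA ltr_pdivrMr// [G0 * M]mulrC.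
have G0p : 0 < M * G0 by apply: le_lt_trans sG; rewrite sqr_ge0.
have lohi : slo < shi.
  have shi0 : 0 <= shi by exact: sqrtr_ge0.
  rewrite -ltr_sqr ?nnegrE ?(ltW s0)// sqr_sigma_hi (lt_le_trans sG)//.
  by rewrite ler_pdivlMr// ler_piMr ?(ltW G0p) ?(ltW eta_lt1).
have shi0 := lt_trans s0 lohi.
case TRpE : (TR (extrapolate x v A shi) shi (M^-1 * shi)) => [dp lp].
have [dpr lp0 complp eqp] := oracle_facts _ _ _ _ shi0 TRpE.
have mup : 0 < shi + lp by rewrite ltr_wpDr.
have dpG := stat _ _ _ shi0 mup eqp.
have shd : M * (shi + lp) * enorm dp <= eta * shi ^+ 2.
  rewrite sqr_sigma_hi -mulrA (mulrC eta) divfK ?gt_eqF//.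
  by rewrite ler_pM2l.
(* On the boundary, [|dp| = shi / M] would contradict [shd] because [eta < 1]. *)
have lp00 : lp = 0.
  case: complp => // dpE; rewrite dpE in shd.
  have e1 : M * (shi + lp) * (shi / M) = (shi + lp) * shi by field; rewrite gt_eqF.
  rewrite e1 in shd.
  have : (1 - eta) * shi ^+ 2 + lp * shi <= 0 by lra.
  have : 0 < (1 - eta) * shi ^+ 2 by rewrite mulr_gt0 ?subr_gt0 ?exprn_gt0.
  have : 0 <= lp * shi by rewrite mulr_ge0// ltW.
  lra.
exists dp, dq, lambda; split; split => //.
- by rewrite expr0 divr1.
- by rewrite -eqp lp00 addr0.
rewrite lp00 addr0 in shd.
rewrite ler_pdivlMr// -(ler_pM2r shi0).
have -> : enorm dp * M * shi = M * shi * enorm dp by ring.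
by have -> : eta * shi * shi = eta * shi ^+ 2 by ring.
Qed.

Variable J : nat.
Hypothesis J_max : forall j : nat,
  2 ^+ j * (kappa ^+ 3 * epsg ^+ 2) <= W * shi -> (j <= J)%N.

(** While the method runs, [m] counts oracle calls, with [J + 2] allotted to each completed outer
    iteration; in [Bisection], one more went to the initial test and [j] to halvings. *)
Definition config_inv (m : nat) (cf : config R n) : Prop :=
  match cf with
  | Terminated x => enorm (grad f x) <= epsg
  | Running k x v A ph => outer_inv k x v A /\
      match ph with
      | InitialTest => (m <= k * (J + 2))%N
      | Bisection lo hi =>
          exists2 j, search_inv x v A lo hi j & (m <= k * (J + 2) + 1 + j)%N
      end
  end.

(** [sigma_lo] is the value at which the bound of [grad_step_le] with [mu = theta * slo] equals
    [epsg]. *)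
Lemma initial_test_grad_le y d lambda :
  TR y slo (M^-1 * slo) = (d, lambda) -> lambda <= (theta - 1) * slo ->
  enorm (grad f (y + d)) <= epsg.
Proof.
move=> TRE ll; have s0 := sigma_lo_gt0.
have [dr l0 _ eqd] := oracle_facts _ _ _ _ s0 TRE.
have mu0 : 0 <= slo + lambda by rewrite addr_ge0// ltW.
apply: le_trans (grad_step_le f M smooth M_gt0 lip y d _ slo eqd mu0 dr) _.
have h : (slo + lambda) * (slo / M) <= theta * slo * (slo / M).
  by rewrite ler_wpM2r ?divr_ge0 ?(ltW s0) ?(ltW M_gt0)//; lra.
have e : theta * slo * (slo / M) + M / 2 * (slo / M) ^+ 2 = epsg.
  have -> : theta * slo * (slo / M) + M / 2 * (slo / M) ^+ 2 =
    slo ^+ 2 * (1 + 2 * theta) / (2 * M) by field; rewrite gt_eqF.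
  rewrite sqr_sigma_lo; have := theta2_gt0 => t2.
  by field; rewrite !gt_eqF.
lra.
Qed.

Lemma config_inv_step m cf : config_inv m cf ->
  config_inv m.+1 (step f TR M G0 theta eta gamma epsg cf).
Proof.
case: cf => [k x v A [|lo hi]|x]//=.
  move=> [oi mk]; rewrite -/slo.
  case TRE : (TR _ _ _) => [d lambda].
  case: ifPn => [ll|]; first exact: initial_test_grad_le TRE ll.
  rewrite -ltNge => ll; split=> //; exists 0%N; last by rewrite addn0 addn1 ltnS.
  exact: initial_search_inv oi TRE ll.
move=> [oi [j si mj]]; have jJ : (j <= J)%N.
  exact/J_max/(search_inv_depth _ _ _ _ _ _ _ oi si).
have [dp [dq [lq [[slolo lohi wE eqp dpr] [eqq dqE ll]]]]] := si.
set mid := (lo + hi) / 2.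
have lom : lo < mid by rewrite /mid; lra.
have mhi : mid < hi by rewrite /mid; lra.
have lo0 := lt_le_trans sigma_lo_gt0 slolo.
have mid0 : 0 < mid by exact: lt_trans lom.
case TRE : (TR _ _ _) => [d lambda].
have [dr l0 compl eqd] := oracle_facts _ _ _ _ mid0 TRE.
have half : (shi - slo) / 2 ^+ j.+1 = (hi - lo) / 2.
  by rewrite wE exprSr invfM mulrA.
have th0 : 0 < (theta - 1) * mid by rewrite mulr_gt0// subr_gt0.
case: ifPn => [/andP[/eqP l00 dsmall]|notint].
  split => //; exists j.+1; last by rewrite addnS ltnS.
  exists d, dq, lq; split; split => //; first by rewrite half /mid; field.
    by rewrite -eqd l00 addr0.
  by rewrite mulrAC ltW.
case: ifPn => [lbig|].
  split => //; exists j.+1; last by rewrite addnS ltnS.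
  exists dp, d, lambda; split; split => //.
  - exact: le_trans slolo (ltW lom).
  - by rewrite half /mid; field.
  by case: compl => // l00; move: lbig; rewrite l00 ltNge ltW.
rewrite -leNgt => lsmall; split; last first.
  by rewrite mulSn; exact: search_budget mj jJ.
apply: outer_inv_step lsmall _ dr => //.
(* Failure of test i) gives the length bound directly or a nonzero multiplier; then the step lies on
   the boundary and [eta < 1] suffices. *)
have := notint; rewrite negb_and -leNgt => /orP[l0n|//].
case: compl => [l00|->]; first by rewrite l00 eqxx in l0n.
by rewrite mulrAC ler_wpM2r ?invr_ge0 ?(ltW M_gt0)// ler_piMl// ltW.
Qed.

Lemma run_inv m : config_inv m (run f TR M G0 theta eta gamma epsg x0 m).
Proof.
elim: m => [|m IH]; last by rewrite /run iterS; exact: config_inv_step.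
by split => //=; exact: outer_inv0.
Qed.

(** A run still active after this many calls has completed more than [Kmax] outer iterations, so its
    last point has gap at most [epsf]; a terminated run has output a point with small gradient. *)
Lemma finds_within_budget (epsf : R) (Kmax : nat) : 0 < epsf ->
  (forall k : nat,
     k%:R <= outer_const M D0 eta gamma * epsf `^ (- (2 / 7)) -> (k <= Kmax)%N) ->
  finds_within f TR M G0 theta eta gamma epsg
    (approximate_solution f xs epsf epsg) x0 (Kmax.+1 * (J + 2)).
Proof.
move=> e0 Kmax_max; set N := (_ * _)%N.
have := run_inv N; case runE : (run _ _ _ _ _ _ _ _ _ _) => [k x v A ph|x] /=.
  move=> [oi phN]; have [kbig|kle] := ltnP Kmax k.
    exists N => //; exists x; first by rewrite runE; case: k kbig {oi phN runE}.
    left; rewrite leNgt; apply/negP => fx.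
    by have := Kmax_max _ (outer_inv_count _ _ _ _ _ oi e0 fx); rewrite leqNgt kbig.
  have kJ : (k * (J + 2) <= Kmax * (J + 2))%N by rewrite leq_mul2r kle orbT.
  exfalso; case: ph phN {runE} => [|lo hi [j si]].
    rewrite /N mulSn => /leq_trans/(_ kJ).
    by rewrite -[leqRHS]add0n leq_add2r addn2.
  have jJ : (j <= J)%N by exact/J_max/(search_inv_depth _ _ _ _ _ _ _ oi si).
  move=> /search_budget/(_ jJ).
  by rewrite /N mulSn ltn_add2l ltnNge kJ.
by move=> gx; exists N => //; exists x; [rewrite runE|right].
Qed.

End TrustRegionExtragradient.

(** * Logarithms and the final count *)

Lemma log2_gt0 {R : realType} (x : R) : 1 < x -> 0 < log2 x.
Proof. by move=> x1; rewrite divr_gt0 ?ln_gt0// ltr1n. Qed.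

Lemma ler_log2 {R : realType} (x y : R) : 0 < x -> x <= y -> log2 x <= log2 y.
Proof.
move=> x0 xy; rewrite ler_pM2r ?invr_gt0 ?ln_gt0 ?ltr1n//.
by rewrite ler_ln ?posrE// (lt_le_trans x0).
Qed.

Lemma depth_le_log2 {R : realType} (j : nat) (e P : R) : 0 < e ->
  2 ^+ j * e ^+ 2 <= P -> j%:R <= log2 P + 2 * log2 (1 / e).
Proof.
move=> e0 h; have ln2 : 0 < ln 2 :> R by rewrite ln_gt0// ltr1n.
have j0 : 0 < (2 : R) ^+ j by rewrite exprn_gt0.
have e2 : 0 < e ^+ 2 by rewrite exprn_gt0.
have P0 : 0 < P by apply: lt_le_trans h; rewrite mulr_gt0.
have : ln (2 ^+ j * e ^+ 2) <= ln P by rewrite ler_ln ?posrE// mulr_gt0.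
rewrite lnM ?posrE// !lnXn// /log2 div1r lnV ?posrE// => lnh.
rewrite mulrA -mulrDl ler_pdivlMr// mulr_natl.
move: lnh; rewrite -[ln e *+ 2]mulr_natl; lra.
Qed.

Lemma le_truncn {R : realType} (x : R) (k : nat) : k%:R <= x -> (k <= Num.truncn x)%N.
Proof. by move=> kx; rewrite truncn_ge_nat// (le_trans _ kx). Qed.

(* The constant C hidden in the O depends neither on the tolerances epsf and
   epsg, nor on the dimension, the function, the points or the oracle.
   As log (1 / epsg) vanishes at epsg = 1, C is uniform over epsg <= delta, for
   each delta < 1. *)
Theorem theorem4p9 (R : realType) (M D0 G0 theta eta gamma delta : R)
    (M_gt0 : 0 < M) (theta_gt1 : 1 < theta)
    (eta_gt0 : 0 < eta) (eta_lt1 : eta < 1)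
    (gamma_gt0 : 0 < gamma) (gamma_le : gamma <= theta^-1)
    (delta_gt0 : 0 < delta) (delta_lt1 : delta < 1) :
  exists C : R,
  forall (n : nat) (f : 'rV[R]_n -> R) (xstar x0 : 'rV[R]_n)
    (TR : 'rV[R]_n -> R -> R -> 'rV[R]_n * R) (epsf epsg : R),
  convex f ->
  twice_continuously_differentiable f ->
  lipschitz_hess f M ->
  minimizer f xstar ->
  enorm (x0 - xstar) = D0 ->
  maximal_gradient_norm f xstar ((4 / Num.sqrt (3 * gamma) + 1) * D0) G0 ->
  tr_oracle f TR ->
  0 < epsf -> epsf < 1 ->
  0 < epsg -> epsg <= delta ->
  exists2 N : nat,
    N%:R <= C * (epsf `^ (- (2 / 7)) * log2 (1 / epsg)) &
    finds_within f TR M G0 theta eta gamma epsg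
      (approximate_solution f xstar epsf epsg) x0 N.
Proof.
pose kappa := sigma_lo_max M theta.
pose a := `|log2 (gap_const M D0 G0 theta eta gamma * sigma_hi M G0 eta / kappa ^+ 3)|.
pose o := `|outer_const M D0 eta gamma|.
pose l0 := log2 (1 / delta).
(* The first factor comes from the number of outer iterations, the second from the calls per search,
   divided by [log2 (1 / epsg)]. *)
exists ((o + 1) * ((a + 2) / l0 + 2)).
move=> n f xs x0 TR epsf epsg cvx smooth lip xs_min x0D0 G0max oracle
  epsf0 epsf1 epsg0 epsg_le.
have epsg1 : epsg < 1 by apply: le_lt_trans delta_lt1.
pose l := log2 (1 / epsg).
have l0_gt0 : 0 < l0 by rewrite log2_gt0// ltr_pdivlMr// mul1r.
have l0l : l0 <= l by rewrite ler_log2 ?divr_gt0// ler_pM2l// lef_pV2.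
have l_gt0 : 0 < l by apply: lt_le_trans l0l.
have kappa0 : 0 < kappa by exact: sigma_lo_max_gt0.
pose E := epsf `^ (- (2 / 7)).
(* This absorbs the rounding of the outer count into [(o + 1) * E]. *)
have E1 : 1 <= E.
  by rewrite -[leLHS](powRr0 epsf) ger_powR ?epsf0 ?(ltW epsf1)// oppr_le0 divr_ge0.
pose J := Num.truncn (a + 2 * l).
have a0 : 0 <= a by exact: normr_ge0.
have o0 : 0 <= o by exact: normr_ge0.
have al0 : 0 <= a + 2 * l by rewrite addr_ge0// mulr_ge0// ltW.
have J_max (j : nat) : 2 ^+ j * (kappa ^+ 3 * epsg ^+ 2) <=
    gap_const M D0 G0 theta eta gamma * sigma_hi M G0 eta -> (j <= J)%N.
  move=> h; apply: le_truncn.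
  have h' : 2 ^+ j * epsg ^+ 2 <=
      gap_const M D0 G0 theta eta gamma * sigma_hi M G0 eta / kappa ^+ 3.
    by rewrite ler_pdivlMr ?exprn_gt0// -mulrA (mulrC (_ ^+ 2)).
  apply: le_trans (depth_le_log2 _ _ _ epsg0 h') _.
  by rewrite lerD2r ler_norm.
have oE0 : 0 <= o * E by rewrite mulr_ge0// (le_trans ler01).
exists ((Num.truncn (o * E)).+1 * (J + 2))%N; last first.
  apply: (finds_within_budget M D0 G0 theta eta gamma epsg) => // k kle.
  apply/le_truncn/(le_trans kle); rewrite ler_wpM2r ?ler_norm//.
  by rewrite (le_trans ler01).
have KE : ((Num.truncn (o * E)).+1)%:R <= (o + 1) * E.
  rewrite -natr1 mulrDl mul1r; apply: lerD => //.
  by have /andP[] := truncn_itv oE0.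
have JE : (J + 2)%:R <= ((a + 2) / l0 + 2) * l.
  rewrite natrD mulrDl.
  have /andP[Jle _] := truncn_itv al0.
  (* Additive constants become multiples of [l] because [l >= l0 > 0]; here the bound [delta < 1]
     enters. *)
  have : a + 2 <= (a + 2) / l0 * l.
    rewrite mulrAC ler_pdivlMr//; apply: ler_wpM2l => //; lra.
  lra.
rewrite natrM -/E -/l.
have -> : (o + 1) * ((a + 2) / l0 + 2) * (E * l) =
  ((o + 1) * E) * (((a + 2) / l0 + 2) * l) by ring.
by apply: ler_pM.
Qed.
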